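(* For every real $\alpha>-1$, the asymptotic Markov constant $c(\alpha)=\lim_{n\to\infty}\frac{c_n(\alpha)}{n}$ satisfies $$\frac{\sqrt{2}}{\sqrt{(\alpha+1)(\alpha+5)}}\le c(\alpha)\le\frac{1}{\sqrt{\alpha+1}\,\sqrt[6]{(\alpha+3)(\alpha+5)}}.$$
   Context: $\mathcal{P}_n$ is the set of algebraic polynomials of degree not exceeding $n$. For $\alpha>-1$, $w_\alpha(t)=t^\alpha e^{-t}$ on $(0,\infty)$ is the Laguerre weight and $\Vert f\Vert_{w_\alpha}=\left(\int_0^\infty t^\alpha e^{-t}|f(t)|^2\,dt\right)^{1/2}$. The best Markov constant is $c_n(\alpha)=\sup_{p\in\mathcal{P}_n,\ p\neq 0}\frac{\Vert p'\Vert_{w_\alpha}}{\Vert p\Vert_{w_\alpha}}$. The limit defining $c(\alpha)$ is known to exist (a result of Dörfler, 2002). *)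

(* Defs.v *)
(* Stdlib reals with Coquelicot. *)
From Stdlib Require Import Reals.
From Coquelicot Require Import Coquelicot.
Open Scope R_scope.

Definition poly_le (n : nat) (p : R -> R) : Prop :=
  exists a : nat -> R, forall t : R, p t = sum_f_R0 (fun k => a k * t ^ k) n.

(* [Rpower t alpha] is the real power only for [t > 0]; the weight is used
   on (0, +oo) only. *)
Definition laguerre_weight (alpha t : R) : R := Rpower t alpha * exp (- t).

(* The integral is improper at both ends: the weight is unbounded at 0 when
   [alpha < 0].  It converges for every polynomial [f] when [alpha > -1]. *)
Definition laguerre_norm (alpha : R) (f : R -> R) : R :=
  sqrt (RInt_gen (fun t => laguerre_weight alpha t * Rabs (f t) ^ 2)
                 (at_right 0) (Rbar_locally p_infty)).

Definition markov_const (alpha : R) (n : nat) : Rbar :=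
  Lub_Rbar (fun r : R => exists p : R -> R,
    poly_le n p /\ (exists t : R, p t <> 0) /\
    r = laguerre_norm alpha (Derive p) / laguerre_norm alpha p).

(* [markov_const alpha n] is finite for [alpha > -1], so [real] only forgets
   its type.  The term of index 0 is a division by 0 and is irrelevant to the
   limit.  [Lim_seq] is total; this sequence converges (Doerfler 2002), so it is
   the genuine limit here. *)
Definition asymptotic_markov_const (alpha : R) : Rbar :=
  Lim_seq (fun n : nat => real (markov_const alpha n) / INR n).

(* Main.v *)
Require Import Defs.
From Stdlib Require Import Reals.
From Coquelicot Require Import Coquelicot.
From Stdlib Require Import Lra Lia FunctionalExtensionality.
From mathcomp Require all_boot all_order all_algebra ring Rstruct.
Open Scope R_scope.

(** Write [s = alpha + 1] and let [L_k] be the Laguerre polynomials for the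
    weight [t^alpha e^(-t)].  They satisfy [L_k' = - (L_0 + ... + L_(k-1))], so
    for [p = sum_(k <= n) c_k L_k] with partial sums [C_k = c_0 + ... + c_k]
    one has [p' = sum_k (C_k - C_n) L_k].  With [h_k] the squared norm of
    [L_k], the Markov constant is thus the best constant in a weighted discrete
    Hardy inequality
      [sum_k h_k (C_n - C_k)^2 <= M^2 * sum_k h_k c_k^2],
    and everything there follows from the single recurrence
    [(k + 1) h_(k+1) = (k + s) h_k]: the sums that occur telescope to rational
    functions of [n] and [s].

    Upper bound.  After rescaling by the square roots of the [h_k], the Hardy
    form is the quadratic form of a positive matrix [A = B^T B], whose entries
    involve only [h_0 + ... + h_(k-1) = k h_k / s].  The largest eigenvalue of
    [A] is at most the cube root of [tr A^3]
    ([sqnorm_mulmx_cube_le]; the spectral theorem is replaced by two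
    Cauchy-Schwarz inequalities), and [tr A^3] is an explicit polynomial of
    degree 6 in [n] with leading coefficient
    [1 / (s^3 (s + 2) (s + 4))] ([sum_kernel3]).

    Lower bound.  The vector [c_k = k], for which [C_n - C_k] is a discrete
    version of the function [1 - x^2] on [[0, 1]], gives a Rayleigh quotient
    asymptotic to [2 n^2 / (s (s + 4))] ([test_vector_ratio]).

    Both bounds hold for every [n > 0], and [Lim_seq] is monotone, so the limit
    is bounded by the limits of the two bounds.

    The analytic input is small.  The integrals [int t^b e^(-t)] converge for
    [b > -1] ([is_RInt_gen_laguerre_weight]), and
    [int (t^(alpha+1) e^(-t) q)' = 0] for a polynomial [q]
    ([is_laguerre_integral_divergence]).  The latter makes the Laguerre
    differential operator symmetric, whence orthogonality
    ([laguerre_orthogonal]) and the recurrence for [h_k] ([laguerre_sqnormS]). *)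

(** * Quadratic forms and the cube of the Hardy matrix *)

Section Trace.
Import all_boot all_order all_algebra ring.
Local Set Implicit Arguments.
Local Unset Strict Implicit.
Local Unset Printing Implicit Defensive.
Import Order.TTheory GRing.Theory Num.Theory.
Local Open Scope ring_scope.

(** Lagrange's identity: twice the defect is the sum of the squares of the
    2x2 minors. *)
Lemma cauchy_schwarz_sum (F : realFieldType) (I : finType) (x y : I -> F) :
  (\sum_i x i * y i) ^+ 2 <= (\sum_i x i ^+ 2) * (\sum_i y i ^+ 2).
Proof.
rewrite -subr_ge0 -(pmulr_rge0 _ (ltr0n F 2)).
suff -> : 2 * ((\sum_i x i ^+ 2) * (\sum_i y i ^+ 2) - (\sum_i x i * y i) ^+ 2)
        = \sum_i \sum_j (x i * y j - x j * y i) ^+ 2.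
  by do 2![apply: sumr_ge0 => ? _]; exact: sqr_ge0.
have prod_sum (a b : I -> F) :
  (\sum_i a i) * (\sum_i b i) = \sum_i \sum_j a i * b j.
  by rewrite mulr_suml; apply: eq_bigr => i _; rewrite mulr_sumr.
have -> : 2 * ((\sum_i x i ^+ 2) * (\sum_i y i ^+ 2) - (\sum_i x i * y i) ^+ 2)
  = (\sum_i x i ^+ 2) * (\sum_i y i ^+ 2)
    + (\sum_i y i ^+ 2) * (\sum_i x i ^+ 2)
    - 2 * ((\sum_i x i * y i) * (\sum_i x i * y i)) by ring.
rewrite !prod_sum mulr_sumr -big_split -sumrB /=; apply: eq_bigr => i _.
rewrite mulr_sumr -big_split -sumrB /=; apply: eq_bigr => j _; ring.
Qed.

Definition sqnorm (F : realFieldType) n (x : 'cV[F]_n) : F :=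
  \sum_i x i 0 ^+ 2.

Lemma sqnorm_ge0 (F : realFieldType) n (x : 'cV[F]_n) : 0 <= sqnorm x.
Proof. by apply: sumr_ge0 => i _; exact: sqr_ge0. Qed.

Lemma sqnormE (F : realFieldType) n (x : 'cV[F]_n) :
  sqnorm x = (x^T *m x) 0 0.
Proof. by rewrite mxE; apply: eq_bigr => i _; rewrite mxE expr2. Qed.

Lemma cauchy_schwarz_mx (F : realFieldType) n (x y : 'cV[F]_n) :
  (x^T *m y) 0 0 ^+ 2 <= sqnorm x * sqnorm y.
Proof.
rewrite mxE; under eq_bigr => i _ do rewrite mxE.
exact: cauchy_schwarz_sum.
Qed.

(** The Hilbert-Schmidt norm bounds the operator norm. *)
Lemma sqnorm_mulmx_le (F : realFieldType) m n (C : 'M[F]_(m, n)) x :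
  sqnorm (C *m x) <= \tr (C^T *m C) * sqnorm x.
Proof.
rewrite mxtrace_mulC /mxtrace /sqnorm mulr_suml.
apply: ler_sum => i _; rewrite !mxE.
under [X in _ <= X * _]eq_bigr => j _ do rewrite mxE -expr2.
exact: cauchy_schwarz_sum.
Qed.

(** This is [lambda^3 <= tr A^3] for the largest eigenvalue [lambda] of [A],
    stated as a bound on the Rayleigh quotient so that no eigenvector is
    needed.  With [<.,.>] the dot product, Cauchy-Schwarz gives
    [<A x, x>^2 <= |x|^2 |A x|^2] and
    [|A x|^4 = <B x, B A x>^2 <= |B x|^2 |B A x|^2]; combine them, divide by
    [|B x|^2 = <A x, x>], and bound [|B A x|^2] by the Hilbert-Schmidt norm of
    [B A], whose square is [tr A^3]. *)
Lemma sqnorm_mulmx_cube_le (F : realFieldType) m n (B : 'M[F]_(m, n)) A x :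
  A = B^T *m B ->
  sqnorm (B *m x) ^+ 3 <= \tr (A *m A *m A) * sqnorm x ^+ 3.
Proof.
move=> defA.
set q := sqnorm (B *m x); set N := sqnorm x; set P := sqnorm (A *m x).
set W := sqnorm (B *m (A *m x)).
have symA : A^T = A by rewrite defA trmx_mul trmxK.
have qP : q ^+ 2 <= N * P.
  have -> : q = (x^T *m (A *m x)) 0 0.
    by rewrite /q sqnormE trmx_mul defA !mulmxA.
  exact: cauchy_schwarz_mx.
have PW : P ^+ 2 <= q * W.
  have -> : P = ((B *m x)^T *m (B *m (A *m x))) 0 0.
    by rewrite /P sqnormE !trmx_mul symA defA !mulmxA.
  exact: cauchy_schwarz_mx.
have WT : W <= \tr (A *m A *m A) * N.
  have -> : A *m A *m A = (B *m A)^T *m (B *m A).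
    by rewrite trmx_mul symA defA !mulmxA.
  by rewrite /W mulmxA; exact: sqnorm_mulmx_le.
have [q0 N0 P0] : [/\ 0 <= q, 0 <= N & 0 <= P] by split; exact: sqnorm_ge0.
have qW : q ^+ 3 <= N ^+ 2 * W.
  have [->|qn0] := eqVneq q 0.
    by rewrite expr0n mulr_ge0 ?sqr_ge0 ?sqnorm_ge0.
  have qp : 0 < q by rewrite lt_def qn0.
  rewrite -(ler_pM2l qp) -exprS.
  apply: (@le_trans _ _ ((N * P) ^+ 2)).
    have -> : q ^+ 4 = (q ^+ 2) ^+ 2 by rewrite -exprM.
    by rewrite ler_sqr ?nnegrE ?sqr_ge0 ?mulr_ge0.
  have -> : q * (N ^+ 2 * W) = N ^+ 2 * (q * W) by ring.
  by rewrite exprMn ler_wpM2l ?sqr_ge0.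
apply: (le_trans qW).
have -> : \tr (A *m A *m A) * N ^+ 3 = N ^+ 2 * (\tr (A *m A *m A) * N) by ring.
by rewrite ler_wpM2l ?sqr_ge0.
Qed.

(** The triples gained when [n] becomes [n + 1] are grouped by the number of
    entries equal to [n]. *)
Lemma sum3_recr (F : comNzRingType) (G : nat -> nat -> nat -> F) n :
    (forall i j k, G i j k = G j i k) -> (forall i j k, G i j k = G i k j) ->
  \sum_(i < n.+1) \sum_(j < n.+1) \sum_(k < n.+1) G i j k =
  \sum_(i < n) \sum_(j < n) \sum_(k < n) G i j k
  + 3 * (\sum_(i < n) \sum_(j < n) G i j n)
  + 3 * (\sum_(i < n) G i n n) + G n n n.
Proof.
move=> symL symR.
have recr2 i : \sum_(j < n.+1) \sum_(k < n.+1) G i j k =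
  \sum_(j < n) \sum_(k < n) G i j k + 2 * (\sum_(j < n) G i j n) + G i n n.
  under eq_bigr => j _ do rewrite big_ord_recr /=.
  rewrite big_ord_recr /= big_split /=.
  under [X in _ + (X + _) = _]eq_bigr => k _ do rewrite symR.
  ring.
under eq_bigr => i _ do rewrite recr2.
rewrite big_ord_recr /= !big_split /= -mulr_sumr.
have -> : \sum_(j < n) \sum_(k < n) G n j k = \sum_(i < n) \sum_(j < n) G i j n.
  apply: eq_bigr => i _; apply: eq_bigr => j _.
  by rewrite symL symR.
have -> : \sum_(j < n) G n j n = \sum_(i < n) G i n n.
  by apply: eq_bigr => i _; rewrite symL.
ring.
Qed.

(** The polynomial in [x = n] that [tr A^3] turns out to be; see
    [sum_kernel3]. *)
Definition trace_cubed (F : fieldType) (s x : F) : F :=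
  (x * (114 * s ^+ 2 + 6 * s ^+ 3)
   + x ^+ 2 * (150 * s + 120 * s ^+ 2 + 65 * s ^+ 3 + 5 * s ^+ 4)
   + x ^+ 3 * (60 + 320 * s + 140 * s ^+ 2 + 70 * s ^+ 3 + 10 * s ^+ 4)
   + x ^+ 4 * (180 + 270 * s + 210 * s ^+ 2 + 35 * s ^+ 3 + 5 * s ^+ 4)
   + x ^+ 5 * (180 + 180 * s + 96 * s ^+ 2 + 24 * s ^+ 3)
   + x ^+ 6 * (60 + 80 * s + 20 * s ^+ 2))
  / (20 * (s ^+ 3 * (s + 1) * (s + 2) * (s + 3) * (s + 4))).

Section Kernel.
Variables (F : rcfType) (s : F) (h : nat -> F).
Hypotheses (s_gt0 : 0 < s) (h0_gt0 : 0 < h 0%N).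
Hypothesis hS : forall k, k.+1%:R * h k.+1 = (k%:R + s) * h k.

Lemma weight_gt0 k : 0 < h k.
Proof.
elim: k => // k IHk.
by rewrite -(pmulr_rgt0 _ (ltr0Sn F k)) hS mulr_gt0 // ltr_wpDl.
Qed.

Definition partial_mass k := k%:R * h k / s.

(** The sum telescopes, and this is what makes the Hardy matrix explicit. *)
Lemma sum_weight k : \sum_(j < k) h j = partial_mass k.
Proof.
have s_neq0 : s != 0 by rewrite gt_eqF.
elim: k => [|k IHk]; first by rewrite big_ord0 /partial_mass !mul0r.
by rewrite big_ord_recr /= IHk /partial_mass hS; field.
Qed.

Let S i := partial_mass i.+1.
Let H i := h i.+1.

Let H_neq0 i : H i != 0. Proof. by rewrite gt_eqF ?weight_gt0. Qed.

Let H_S i : (i%:R + 2) * H i.+1 = (i%:R + 1 + s) * H i.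
Proof. by rewrite natr1 -natrD addn2 /H hS. Qed.

(** The entries of [A] are [S (min i j) / sqrt (H i * H j)]; in a product along
    a closed path the square roots pair up.  Indices are shifted by one,
    because the coefficient of [L_0] does not contribute to the derivative. *)
Definition kernel3 i j k :=
  S (minn i j) * S (minn j k) * S (minn k i) / (H i * H j * H k).

(* [V] and [U] are the closed forms of the single and double sums that appear
   when [sum3_recr] is applied to [kernel3]; the coefficients of these
   polynomials in [n] are forced by the telescoping in [sum_kernel1] and
   [sum_kernel2]. *)
Let V n := n%:R * (n%:R * (s + 1) + 1)
           / (s ^+ 2 * (s + 1) * (s + 2)) * ((n%:R + 1) * H n).
Let U n := n%:R * (5 * s - s ^+ 2 + n%:R * (6 + 5 * s + 5 * s ^+ 2)
   + n%:R ^+ 2 * (12 + 8 * s + 3 * s ^+ 2 + s ^+ 3)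
   + n%:R ^+ 3 * (6 + 8 * s + 2 * s ^+ 2))
  / (s ^+ 3 * (s + 1) * (s + 2) * (s + 3) * (s + 4)) * ((n%:R + 1) * H n).

Let nz : [/\ s != 0, s + 1 != 0, s + 2 != 0, s + 3 != 0 & s + 4 != 0].
Proof. by split; rewrite gt_eqF // ltr_wpDr. Qed.

Lemma sum_kernel1 n : \sum_(i < n) S i ^+ 2 / H i = V n.
Proof.
have [? ? ? ? ?] := nz.
elim: n => [|n IHn]; first by rewrite big_ord0 /V !mul0r.
rewrite big_ord_recr /= IHn /V (_ : n.+1%:R + 1 = n%:R + 2) ?H_S; last by rewrite -natr1; ring.
rewrite /S /partial_mass -/(H n) -!natr1; have Hn := H_neq0 n.
field; by do ?[apply/andP; split].
Qed.

Lemma sum2_recr (G : nat -> nat -> F) n : (forall i j, G i j = G j i) ->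
  \sum_(i < n.+1) \sum_(j < n.+1) G i j =
  \sum_(i < n) \sum_(j < n) G i j + 2 * (\sum_(i < n) G i n) + G n n.
Proof.
move=> symG; under eq_bigr => i _ do rewrite big_ord_recr /=.
rewrite big_ord_recr big_split /=.
under [X in _ + (X + _) = _]eq_bigr => j _ do rewrite symG.
ring.
Qed.

Lemma sum_kernel2 n :
  \sum_(i < n) \sum_(j < n) S i * S j * S (minn i j) / (H i * H j) = U n.
Proof.
have [? ? ? ? ?] := nz.
elim: n => [|n IHn]; first by rewrite big_ord0 /U !(mul0r, expr0n, addr0).
rewrite (@sum2_recr (fun i j => S i * S j * S (minn i j) / (H i * H j))); last first.
  by move=> i j; rewrite minnC [S i * _]mulrC [H i * _]mulrC.
have -> : \sum_(i < n) S i * S n * S (minn i n) / (H i * H n) = S n / H n * V n.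
  rewrite -sum_kernel1 mulr_sumr; apply: eq_bigr => i _.
  rewrite (minn_idPl (ltnW (ltn_ord i))).
  have := H_neq0 n; have := H_neq0 i; move=> ? ?; by field; do ?[apply/andP; split].
rewrite IHn minnn /U /V (_ : n.+1%:R + 1 = n%:R + 2) ?H_S; last by rewrite -natr1; ring.
rewrite /S /partial_mass -/(H n) -!natr1; have Hn := H_neq0 n.
field; by do ?[apply/andP; split].
Qed.

(** The increment in [n] consists of the double sum [U], the single sum [V] and
    one diagonal term.  All three are polynomials in [n] once divided by
    suitable powers of [H n], since [S n / H n = (n + 1) / s]. *)
Lemma sum_kernel3 n :
  \sum_(i < n) \sum_(j < n) \sum_(k < n) kernel3 i j k = trace_cubed s n%:R.
Proof.
have [? ? ? ? ?] := nz.
elim: n => [|n IHn].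
  by rewrite big_ord0 /trace_cubed !(mul0r, expr0n, addr0).
have -> := @sum3_recr F kernel3.
2,3: move=> i j k; rewrite /kernel3 ?[minn j i]minnC ?[minn k j]minnC ?[minn k i]minnC; congr (_ / _); ring.
have -> : \sum_(i < n) \sum_(j < n) kernel3 i j n = U n / H n.
  rewrite -sum_kernel2 mulr_suml; apply: eq_bigr => i _.
  rewrite mulr_suml; apply: eq_bigr => j _; rewrite /kernel3.
  rewrite (minn_idPl (ltnW (ltn_ord j))) minnC (minnC n) (minn_idPl (ltnW (ltn_ord i))) minnC.
  have := H_neq0 n; have := H_neq0 i; have := H_neq0 j; move=> ? ? ?; by field; do ?[apply/andP; split].
have -> : \sum_(i < n) kernel3 i n n = S n / H n * (V n / H n).
  rewrite -sum_kernel1 mulr_suml mulr_sumr; apply: eq_bigr => i _; rewrite /kernel3.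
  rewrite minnn (minnC n) (minn_idPl (ltnW (ltn_ord i))).
  have := H_neq0 n; have := H_neq0 i; move=> ? ?; by field; do ?[apply/andP; split].
rewrite IHn /kernel3 !minnn.
(* One common denominator turns the rational identity into a polynomial one. *)
have Hn := H_neq0 n; set D := 20 * (s ^+ 3 * (s + 1) * (s + 2) * (s + 3) * (s + 4)).
have -> : U n / H n = 20 * n%:R * (n%:R + 1) * (5 * s - s ^+ 2
   + n%:R * (6 + 5 * s + 5 * s ^+ 2)
   + n%:R ^+ 2 * (12 + 8 * s + 3 * s ^+ 2 + s ^+ 3)
   + n%:R ^+ 3 * (6 + 8 * s + 2 * s ^+ 2)) / D.
  by rewrite /U /D; field; do ?[apply/andP; split].
have -> : S n / H n * (V n / H n) = 20 * n%:R * (n%:R + 1) ^+ 2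
   * (n%:R * (s + 1) + 1) * (s + 3) * (s + 4) / D.
  rewrite /V /S /partial_mass -/(H n) -natr1 /D.
  by field; do ?[apply/andP; split].
have -> : S n * S n * S n / (H n * H n * H n) =
    20 * (n%:R + 1) ^+ 3 * (s + 1) * (s + 2) * (s + 3) * (s + 4) / D.
  rewrite /S /partial_mass -/(H n) -natr1 /D.
  by field; do ?[apply/andP; split].
rewrite /trace_cubed -/D !(mulrA 3) -!mulrDl -natr1; congr (_ / D); ring.
Qed.

(** The sum that is cubed on the left is [|B x|^2] for an upper triangular
    summation matrix [B], once both sides are rescaled to the unweighted norm. *)
Lemma discrete_hardy (a : nat -> F) n :
  (\sum_(j < n) h j * (\sum_(i < n | (j <= i)%N) a i.+1) ^+ 2) ^+ 3
  <= trace_cubed s n%:R * (\sum_(i < n) h i.+1 * a i.+1 ^+ 2) ^+ 3.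
Proof.
pose B : 'M[F]_n :=
  \matrix_(j, i) (Num.sqrt (h j) / Num.sqrt (H i) * (j <= i)%N%:R).
pose x : 'cV[F]_n := \col_i (Num.sqrt (H i) * a i.+1).
have sq_sqrt k : Num.sqrt (h k) ^+ 2 = h k by rewrite sqr_sqrtr ?ltW ?weight_gt0.
have sq_sqrtH k : Num.sqrt (H k) ^+ 2 = H k by exact: sq_sqrt.
have sqrtH_neq0 i : Num.sqrt (H i) != 0.
  by rewrite sqrtr_eq0 -ltNge weight_gt0.
have -> : \sum_(i < n) h i.+1 * a i.+1 ^+ 2 = sqnorm x.
  by apply: eq_bigr => i _; rewrite mxE exprMn sq_sqrt.
have -> : \sum_(j < n) h j * (\sum_(i < n | (j <= i)%N) a i.+1) ^+ 2 =
          sqnorm (B *m x).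
  apply: eq_bigr => j _; rewrite mxE -{1}(sq_sqrt j) -exprMn; congr (_ ^+ 2).
  rewrite big_mkcond mulr_sumr; apply: eq_bigr => i _; rewrite !mxE.
  case: (j <= i)%N; last by rewrite !mulr0 mul0r.
  by have := sqrtH_neq0 i; move=> ?; rewrite mulr1; field.
(* [j] contributes exactly when it is at most both [i] and [k]. *)
have entry (i k : 'I_n) : (B^T *m B) i k = S (minn i k) / (Num.sqrt (H i) * Num.sqrt (H k)).
  rewrite mxE /S -sum_weight mulr_suml.
  rewrite (big_ord_widen_cond n xpredT (fun j => h j / (Num.sqrt (H i) * Num.sqrt (H k)))); last first.
    by rewrite (leq_ltn_trans (geq_minl _ _)).
  rewrite [RHS]big_mkcond; apply: eq_bigr => j _; rewrite !mxE /=.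
  rewrite ltnS leq_min -[in RHS](sq_sqrt j).
  have := sqrtH_neq0 i; have := sqrtH_neq0 k; move=> ? ?.
  by do 2!case: (_ <= _)%N; rewrite ?(mulr0, mul0r) //=; by field; do ?[apply/andP; split].
apply: (le_trans (sqnorm_mulmx_cube_le x (erefl _))).
suff -> : \tr (B^T *m B *m (B^T *m B) *m (B^T *m B)) = trace_cubed s n%:R by [].
rewrite -sum_kernel3 -mulmxA; apply: eq_bigr => i _.
rewrite mxE; apply: eq_bigr => j _; rewrite [X in _ * X]mxE mulr_sumr.
apply: eq_bigr => k _; rewrite !entry /kernel3.
rewrite -[in RHS](sq_sqrtH i) -[in RHS](sq_sqrtH j) -[in RHS](sq_sqrtH k).
have := sqrtH_neq0 i; have := sqrtH_neq0 j; have := sqrtH_neq0 k; move=> ? ? ?; by field; do ?[apply/andP; split].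
Qed.
End Kernel.
End Trace.

(** * Convergence of the Gamma integrals *)

Lemma Rpower_pos x y : 0 < Rpower x y.
Proof. apply exp_pos. Qed.

Lemma is_derive_Rpower b t : 0 < t ->
  is_derive (fun x => Rpower x b) t (b * Rpower t (b - 1)).
Proof.
  intros Ht. apply is_derive_Reals. now apply derivable_pt_lim_power.
Qed.

Lemma continuous_Rpower b t : 0 < t -> continuous (fun x => Rpower x b) t.
Proof.
  intros Ht. apply (ex_derive_continuous (fun x => Rpower x b)).
  eexists; now apply is_derive_Rpower.
Qed.

Lemma continuous_expN t : continuous (fun x => exp (- x)) t.
Proof. apply (ex_derive_continuous (fun x => exp (- x))). auto_derive; easy. Qed.

Lemma continuous_laguerre_weight b t : 0 < t -> continuous (laguerre_weight b) t.
Proof.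
  intros Ht. apply (continuous_mult (fun x => Rpower x b)).
  now apply continuous_Rpower. apply continuous_expN.
Qed.

Lemma laguerre_weight_pos b t : 0 < laguerre_weight b t.
Proof. apply Rmult_lt_0_compat; apply exp_pos. Qed.

Lemma ex_RInt_pos (f : R -> R) a b : (forall t, 0 < t -> continuous f t) ->
  0 < a -> 0 < b -> ex_RInt f a b.
Proof.
  intros Cf Ha Hb. apply (ex_RInt_continuous f). intros z [Hz _]. apply Cf.
  apply Rlt_le_trans with (2 := Hz). now apply Rmin_case.
Qed.

Lemma RInt_mono_pos (f : R -> R) a b c d : (forall t, 0 < t -> continuous f t) ->
  (forall t, 0 < t -> 0 <= f t) ->
  0 < a -> a <= b -> b <= c -> c <= d -> RInt f b c <= RInt f a d.
Proof.
  intros Cf Pf Ha Hab Hbc Hcd.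
  assert (E : forall x y, 0 < x -> 0 < y -> ex_RInt f x y)
    by (intros; now apply ex_RInt_pos).
  assert (P : forall x y, 0 < x -> x <= y -> 0 <= RInt f x y).
  { intros x y Hx Hxy. apply RInt_ge_0; try apply E; try lra.
    intros z Hz; apply Pf; lra. }
  pose proof (RInt_Chasles f a b d (E a b ltac:(lra) ltac:(lra)) (E b d ltac:(lra) ltac:(lra))) as H1.
  pose proof (RInt_Chasles f b c d (E b c ltac:(lra) ltac:(lra)) (E c d ltac:(lra) ltac:(lra))) as H2.
  unfold plus in H1, H2; simpl in H1, H2.
  pose proof (P a b ltac:(lra) ltac:(lra)). pose proof (P c d ltac:(lra) ltac:(lra)). lra.
Qed.

(** The limit is the supremum of the integrals over compact intervals, which
    treats the two improper ends at once. *)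
Lemma is_RInt_gen_nonneg_bounded (f : R -> R) M :
  (forall t, 0 < t -> continuous f t) -> (forall t, 0 < t -> 0 <= f t) ->
  (forall a b, 0 < a -> a <= b -> RInt f a b <= M) ->
  exists l, is_RInt_gen f (at_right 0) (Rbar_locally p_infty) l /\
    forall a b, 0 < a -> a <= b -> RInt f a b <= l.
Proof.
  intros Cf Pf HM.
  destruct (completeness (fun r => exists a b, 0 < a /\ a <= b /\ r = RInt f a b))
    as [l [Hub Hleast]].
  - exists M. intros r (a & b & Ha & Hab & ->). now apply HM.
  - exists (RInt f 1 1), 1, 1; repeat split; lra.
  - exists l. split; [|intros a b Ha Hab; apply Hub; now exists a, b].
    intros P [eps HP].
    assert (Hex : exists a b, 0 < a /\ a <= b /\ l - eps < RInt f a b).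
    { apply Classical_Prop.NNPP. intros Hn. pose proof (cond_pos eps).
      assert (l <= l - eps); [|lra]. apply Hleast.
      intros r (a & b & Ha & Hab & ->). apply Rnot_lt_le. intros Hlt.
      apply Hn. now exists a, b. }
    destruct Hex as (a0 & b0 & Ha0 & Hab0 & Hl).
    exists (fun a => 0 < a < a0) (fun b => b0 < b).
    + exists (mkposreal a0 Ha0). intros y Hy Hy0.
      change (Rabs (y - 0) < a0) in Hy. rewrite Rminus_0_r in Hy.
      split; [easy|]. now apply Rle_lt_trans with (1 := Rle_abs y).
    + now exists b0.
    + intros a b [Ha Haa0] Hb. exists (RInt f a b). split.
      * apply (RInt_correct f). apply ex_RInt_pos; simpl; trivial; lra.
      * apply HP. change (Rabs (RInt f a b - l) < eps).
        assert (RInt f a b <= l) by (apply Hub; exists a, b; repeat split; lra).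
        assert (RInt f a0 b0 <= RInt f a b) by (apply RInt_mono_pos; trivial; lra).
        apply Rabs_def1; pose proof (cond_pos eps); lra.
Qed.

(** From [(1 + t) / g <= 1 + t / g <= exp (t / g)], raised to the power [g]. *)
Lemma Rpower_exp_bound g t : 1 <= g -> 0 <= t ->
  Rpower (1 + t) g * exp (- t) <= Rpower g g.
Proof.
  intros Hg Ht.
  assert (H1 : 1 + t <= g * exp (t / g)).
  { apply Rle_trans with (g * (1 + t / g)).
    - replace (g * (1 + t / g)) with (g + t) by (field; lra). lra.
    - apply Rmult_le_compat_l; [lra|]. apply exp_ineq1_le. }
  apply Rle_trans with (Rpower (g * exp (t / g)) g * exp (- t)).
  - apply Rmult_le_compat_r; [left; apply exp_pos|].
    apply Rle_Rpower_l; lra.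
  - rewrite <- Rpower_mult_distr; [|lra|apply exp_pos].
    unfold Rpower at 2. rewrite ln_exp.
    replace (g * (t / g)) with t by (field; lra).
    rewrite Rmult_assoc, <- exp_plus, Rplus_opp_r, exp_0. lra.
Qed.

(** The integrand is dominated by a multiple of the derivative of the bounded
    function [(t / (1 + t))^(b + 1)], by [Rpower_exp_bound] with exponent
    [b + 2]. *)
Lemma is_RInt_gen_laguerre_weight b : -1 < b ->
  exists l, is_RInt_gen (laguerre_weight b) (at_right 0) (Rbar_locally p_infty) l
    /\ 0 < l.
Proof.
  intros Hb.
  set (G := fun t => Rpower (t / (1 + t)) (b + 1)).
  set (g := fun t => (b + 1) * (Rpower t b * Rpower (1 + t) (- (b + 2)))).
  set (C := Rpower (b + 2) (b + 2) / (b + 1)).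
  assert (HC : 0 < C) by (apply Rdiv_lt_0_compat; [apply Rpower_pos|lra]).
  assert (Dg : forall t, 0 < t -> is_derive G t (g t)).
  { intros t Ht. unfold G, g.
    evar_last.
    - apply (is_derive_comp (fun x => Rpower x (b + 1)) (fun t => t / (1 + t))).
      apply is_derive_Rpower. apply Rdiv_lt_0_compat; lra.
      auto_derive. lra. reflexivity.
    - unfold scal; simpl; unfold mult; simpl.
      replace (b + 1 - 1) with b by ring.
      replace (Rpower (t / (1 + t)) b) with (Rpower t b * Rpower (/ (1 + t)) b)
        by (apply Rpower_mult_distr; [lra|apply Rinv_0_lt_compat; lra]).
      replace (Rpower (/ (1 + t)) b) with (Rpower (1 + t) (- (b + 2)) * (1 + t) * (1 + t)).
      + field. lra.
      + unfold Rpower. rewrite ln_Rinv by lra.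
        pattern (1 + t) at 2 3; rewrite <- (exp_ln (1 + t)) by lra.
        rewrite <- !exp_plus. f_equal. ring. }
  assert (Cg : forall t, 0 < t -> continuous g t).
  { intros t Ht. apply (continuous_mult (fun _ => b + 1)); [apply continuous_const|].
    apply (continuous_mult (fun t => Rpower t b)); [now apply continuous_Rpower|].
    apply (continuous_comp (fun t => 1 + t) (fun x => Rpower x (- (b + 2)))).
    - apply (continuous_plus (fun _ => 1) (fun t => t)); [apply continuous_const|apply continuous_id].
    - apply continuous_Rpower; lra. }
  destruct (is_RInt_gen_nonneg_bounded (laguerre_weight b) C) as [l [Hl Hle]].
  - intros; now apply continuous_laguerre_weight.
  - intros; left; apply laguerre_weight_pos.
  - intros x y Hx Hxy.
    assert (Ig : is_RInt g x y (G y - G x)).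
    { apply (is_RInt_derive G); intros z Hz; rewrite Rmin_left in Hz by lra;
      [apply Dg|apply Cg]; lra. }
    apply Rle_trans with (RInt (fun t => C * g t) x y).
    + apply RInt_le; trivial.
      * apply ex_RInt_pos; try lra. intros; now apply continuous_laguerre_weight.
      * apply (ex_RInt_scal g). eexists; exact Ig.
      * intros t Ht. unfold laguerre_weight, g, C.
        pose proof (Rpower_exp_bound (b + 2) t ltac:(lra) ltac:(lra)) as HB.
        pose proof (Rpower_pos t b). pose proof (Rpower_pos (1 + t) (b + 2)).
        rewrite Rpower_Ropp.
        replace (Rpower (b + 2) (b + 2) / (b + 1) *
          ((b + 1) * (Rpower t b * / Rpower (1 + t) (b + 2))))
          with (Rpower t b * (Rpower (b + 2) (b + 2) / Rpower (1 + t) (b + 2)))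
          by (field; lra).
        apply Rmult_le_compat_l; [lra|].
        apply Rle_div_r; trivial. lra.
    + rewrite (RInt_scal g); [|eexists; exact Ig].
      rewrite (is_RInt_unique _ _ _ _ Ig). unfold scal; simpl; unfold mult; simpl.
      assert (0 < G x) by apply Rpower_pos.
      assert (G y <= 1); [|nra].
      unfold G. apply Rle_trans with (Rpower 1 (b + 1)).
      * apply Rle_Rpower_l; [lra|]. split; [apply Rdiv_lt_0_compat; lra|].
        apply Rle_div_l; lra.
      * unfold Rpower. rewrite ln_1, Rmult_0_r, exp_0. lra.
  - exists l. split; trivial.
    apply Rlt_le_trans with (2 := Hle 1 2 ltac:(lra) ltac:(lra)).
    apply RInt_gt_0; [lra| |].
    + intros; apply laguerre_weight_pos.
    + intros; apply continuous_laguerre_weight; lra.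
Qed.

(** The integrand is the derivative of [t^g e^(-t)], which vanishes at both
    ends. *)
Lemma is_RInt_gen_moment_rec g : 0 < g ->
  is_RInt_gen (fun t => g * laguerre_weight (g - 1) t - laguerre_weight g t)
    (at_right 0) (Rbar_locally p_infty) 0.
Proof.
  intros Hg.
  assert (D : forall t, 0 < t -> is_derive (laguerre_weight g) t
     (g * laguerre_weight (g - 1) t - laguerre_weight g t)).
  { intros t Ht. unfold laguerre_weight. evar_last.
    - apply (is_derive_mult (fun x => Rpower x g) (fun x => exp (- x))).
      + now apply is_derive_Rpower.
      + auto_derive; [easy|reflexivity].
      + intros; apply Rmult_comm.
    - unfold plus, mult; simpl; unfold mult; simpl. ring. }
  assert (Pos : filter_prod (at_right 0) (Rbar_locally p_infty)
    (fun ab : R * R => forall x, Rmin (fst ab) (snd ab) <= x -> 0 < x)).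
  { exists (fun a => 0 < a) (fun b => 0 < b).
    - now exists (mkposreal 1 Rlt_0_1).
    - now exists 0.
    - intros a b Ha Hb x Hx. apply Rlt_le_trans with (2 := Hx). simpl.
      now apply Rmin_case. }
  apply (is_RInt_gen_ext (Derive (laguerre_weight g))).
  { revert Pos. apply filter_imp. intros [a b] Hab x Hx. apply is_derive_unique, D.
    apply (Hab x). simpl in *; lra. }
  replace 0 with (0 - 0) at 2 by ring.
  apply is_RInt_gen_Derive.
  - revert Pos. apply filter_imp. intros [a b] Hab x Hx. eexists; apply D.
    apply (Hab x). simpl in *; lra.
  - revert Pos. apply filter_imp. intros [a b] Hab x Hx.
    assert (Hx0 : 0 < x) by (apply (Hab x); simpl in *; lra).
    apply (continuous_ext_loc _ (fun t => g * laguerre_weight (g - 1) t - laguerre_weight g t)).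
    + exists (mkposreal x Hx0). intros y Hy. symmetry. apply is_derive_unique, D.
      change (Rabs (y - x) < x) in Hy. apply Rabs_def2 in Hy. lra.
    + apply (continuous_minus (fun t => g * laguerre_weight (g - 1) t)).
      apply (continuous_mult (fun _ => g)); [apply continuous_const|].
      now apply continuous_laguerre_weight. now apply continuous_laguerre_weight.
  - apply filterlim_locally. intros eps.
    exists (mkposreal _ (Rpower_pos eps (/ g))). intros y Hy Hy0.
    change (Rabs (y - 0) < Rpower eps (/ g)) in Hy. rewrite Rminus_0_r, Rabs_pos_eq in Hy by lra.
    change (Rabs (laguerre_weight g y - 0) < eps).
    rewrite Rminus_0_r, Rabs_pos_eq by (left; apply laguerre_weight_pos).
    apply Rle_lt_trans with (Rpower y g).
    + unfold laguerre_weight. rewrite <- (Rmult_1_r (Rpower y g)) at 2.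
      apply Rmult_le_compat_l; [left; apply Rpower_pos|].
      rewrite <- exp_0. left; apply exp_increasing; lra.
    + apply Rlt_le_trans with (Rpower (Rpower eps (/ g)) g).
      * apply Rlt_Rpower_l; lra.
      * rewrite Rpower_mult, Rinv_l, Rpower_1; [lra|apply cond_pos|lra].
  - apply filterlim_locally. intros eps.
    set (K := Rpower (g + 1) (g + 1)).
    exists (K / eps). intros y Hy.
    assert (HK : 0 < K) by apply Rpower_pos.
    assert (He := cond_pos eps).
    assert (Hy0 : 0 < y) by (apply Rlt_trans with (2 := Hy); now apply Rdiv_lt_0_compat).
    change (Rabs (laguerre_weight g y - 0) < eps).
    rewrite Rminus_0_r, Rabs_pos_eq by (left; apply laguerre_weight_pos).
    pose proof (Rpower_exp_bound (g + 1) y ltac:(lra) ltac:(lra)) as HB. fold K in HB.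
    rewrite Rpower_plus, Rpower_1 in HB by lra.
    assert (Hw : laguerre_weight g y <= Rpower (1 + y) g * exp (- y)).
    { apply Rmult_le_compat_r; [left; apply exp_pos|]. apply Rle_Rpower_l; lra. }
    apply Rlt_div_l in Hy; trivial.
    apply Rle_lt_trans with (1 := Hw).
    assert (0 < Rpower (1 + y) g * exp (- y))
      by (apply Rmult_lt_0_compat; apply exp_pos).
    nra.
Qed.

(** * Integrals of polynomials *)

(** Polynomial functions regardless of degree.  The generators are chosen so that
    each induction below needs only linearity and the step [p] to [t * p],
    which amounts to replacing [alpha] by [alpha + 1]. *)
Inductive polynomial : (R -> R) -> Prop :=
| polynomial_const c : polynomial (fun _ => c)
| polynomial_mulX p : polynomial p -> polynomial (fun t => t * p t)
| polynomial_plus p q : polynomial p -> polynomial q ->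
    polynomial (fun t => p t + q t)
| polynomial_ext p q : (forall t, p t = q t) -> polynomial p -> polynomial q.

Lemma polynomial_mult p q : polynomial p -> polynomial q ->
  polynomial (fun t => p t * q t).
Proof.
  intros Hp Hq; revert p Hp.
  assert (Hscal : forall c, polynomial (fun t => c * q t)).
  { intros c. induction Hq as [d|q Hq IH|q r Hq IHq Hr IHr|q r Hqr Hq IH].
    - apply polynomial_const.
    - eapply polynomial_ext; [|apply polynomial_mulX, IH]. intros; simpl; ring.
    - eapply polynomial_ext; [|apply polynomial_plus; [apply IHq|apply IHr]].
      intros; simpl; ring.
    - eapply polynomial_ext; [|apply IH]. intros; simpl; now rewrite Hqr. }
  induction 1 as [d|p Hp IH|p r Hp IHp Hr IHr|p r Hpr Hp IH].
  - apply Hscal.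
  - eapply polynomial_ext; [|apply polynomial_mulX, IH]. intros; simpl; ring.
  - eapply polynomial_ext; [|apply polynomial_plus; [apply IHp|apply IHr]].
    intros; simpl; ring.
  - eapply polynomial_ext; [|apply IH]. intros; simpl; now rewrite Hpr.
Qed.

Lemma polynomial_scal c p : polynomial p -> polynomial (fun t => c * p t).
Proof. apply (polynomial_mult (fun _ => c)), polynomial_const. Qed.

Lemma polynomial_sum (f : nat -> R -> R) (c : nat -> R) n :
  (forall k, polynomial (f k)) ->
  polynomial (fun t => sum_f_R0 (fun k => c k * f k t) n).
Proof.
  intros Hf. induction n as [|n IH]; simpl.
  - now apply polynomial_scal.
  - apply polynomial_plus; trivial. now apply polynomial_scal.
Qed.

Lemma laguerre_weight_mulX b t : 0 < t ->
  laguerre_weight (b + 1) t = laguerre_weight b t * t.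
Proof.
  intros Ht. unfold laguerre_weight.
  rewrite Rpower_plus, Rpower_1 by trivial. ring.
Qed.

Lemma is_RInt_gen_ext_pos (f g : R -> R) l : (forall t, 0 < t -> f t = g t) ->
  is_RInt_gen f (at_right 0) (Rbar_locally p_infty) l ->
  is_RInt_gen g (at_right 0) (Rbar_locally p_infty) l.
Proof.
  intros Hfg. apply is_RInt_gen_ext.
  exists (fun a => 0 < a) (fun b => 0 < b).
  - now exists (mkposreal 1 Rlt_0_1).
  - now exists 0.
  - intros a b Ha Hb x [Hx _]. apply Hfg. apply Rlt_trans with (2 := Hx). simpl.
    now apply Rmin_case.
Qed.

Definition laguerre_integral (alpha : R) (p : R -> R) : R :=
  RInt_gen (fun t => laguerre_weight alpha t * p t)
    (at_right 0) (Rbar_locally p_infty).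

Definition is_laguerre_integral (alpha : R) (p : R -> R) (l : R) : Prop :=
  is_RInt_gen (fun t => laguerre_weight alpha t * p t)
    (at_right 0) (Rbar_locally p_infty) l.

Lemma is_laguerre_integral_unique alpha p l :
  is_laguerre_integral alpha p l -> laguerre_integral alpha p = l.
Proof. exact (is_RInt_gen_unique (V := R_CompleteNormedModule) _ l). Qed.

Lemma is_laguerre_integral_ext alpha p q l : (forall t, 0 < t -> p t = q t) ->
  is_laguerre_integral alpha p l -> is_laguerre_integral alpha q l.
Proof.
  intros Hpq Hp. refine (is_RInt_gen_ext_pos _ _ _ _ Hp). intros t Ht.
  now rewrite Hpq.
Qed.

Lemma is_laguerre_integral_plus alpha p q lp lq :
  is_laguerre_integral alpha p lp -> is_laguerre_integral alpha q lq ->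
  is_laguerre_integral alpha (fun t => p t + q t) (lp + lq).
Proof.
  intros Hp Hq. refine (is_RInt_gen_ext_pos _ _ _ _ (is_RInt_gen_plus _ _ _ _ Hp Hq)).
  intros t _. unfold plus; simpl. ring.
Qed.

Lemma is_laguerre_integral_scal alpha c p l :
  is_laguerre_integral alpha p l ->
  is_laguerre_integral alpha (fun t => c * p t) (c * l).
Proof.
  intros Hp. refine (is_RInt_gen_ext_pos _ _ _ _ (is_RInt_gen_scal _ c _ Hp)).
  intros t _. unfold scal; simpl; unfold mult; simpl. ring.
Qed.

Lemma is_laguerre_integral_mulX alpha p l :
  is_laguerre_integral (alpha + 1) p l <->
  is_laguerre_integral alpha (fun t => t * p t) l.
Proof.
  split; intros H; refine (is_RInt_gen_ext_pos _ _ _ _ H);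
  intros t Ht; rewrite laguerre_weight_mulX by trivial; ring.
Qed.

(** [alpha] is generalized, as the step [t * p] raises it by one. *)
Lemma polynomial_integrable p : polynomial p ->
  forall alpha, -1 < alpha -> is_laguerre_integral alpha p (laguerre_integral alpha p).
Proof.
  intros Hp alpha Ha.
  cut (exists l, is_laguerre_integral alpha p l).
  { intros [l Hl]. now rewrite (is_laguerre_integral_unique _ _ _ Hl). }
  revert alpha Ha.
  induction Hp as [c|p Hp IH|p q Hp IHp Hq IHq|p q Hpq Hp IH]; intros alpha Ha.
  - destruct (is_RInt_gen_laguerre_weight alpha Ha) as (l & Hl & _).
    exists (c * l). refine (is_RInt_gen_ext_pos _ _ _ _ (is_RInt_gen_scal _ c _ Hl)).
    intros t _. apply Rmult_comm.
  - destruct (IH (alpha + 1)) as [l Hl]; [lra|]. exists l.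
    exact (proj1 (is_laguerre_integral_mulX _ _ _) Hl).
  - destruct (IHp alpha Ha) as [lp Hlp], (IHq alpha Ha) as [lq Hlq].
    exists (lp + lq). exact (is_laguerre_integral_plus _ _ _ _ _ Hlp Hlq).
  - destruct (IH alpha Ha) as [l Hl]. exists l.
    exact (is_laguerre_integral_ext _ _ _ _ (fun t _ => Hpq t) Hl).
Qed.

Lemma is_derive_mulX p t d : is_derive p t d ->
  is_derive (fun t => t * p t) t (p t + t * d).
Proof.
  intros Hp. auto_derive; [now exists d|].
  replace (Derive (fun x => p x) t) with d by (symmetry; now apply is_derive_unique).
  ring.
Qed.

Lemma polynomial_derive p : polynomial p ->
  exists p', forall t, is_derive p t (p' t).
Proof.
  induction 1 as [c|p Hp [p' IH]|p q Hp [p' IHp] Hq [q' IHq]|p q Hpq Hp [p' IH]].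
  - exists (fun _ => 0). intros; apply (is_derive_const (V := R_NormedModule)).
  - exists (fun t => p t + t * p' t). intros t. now apply is_derive_mulX.
  - exists (fun t => p' t + q' t). intros t.
    apply (is_derive_plus p q); trivial.
  - exists p'. intros t. now apply (is_derive_ext p).
Qed.

(** The integrand is [(t^(alpha+1) e^(-t) p)'].  By linearity this reduces to
    monomials, hence to [is_RInt_gen_moment_rec]. *)
Lemma is_laguerre_integral_divergence alpha p p' : -1 < alpha ->
  polynomial p -> (forall t, is_derive p t (p' t)) ->
  is_laguerre_integral alpha (fun t => t * p' t + (alpha + 1 - t) * p t) 0.
Proof.
  intros Ha Hp Hp'. revert alpha Ha p' Hp'.
  induction Hp as [c|p Hp IH|p q Hp IHp Hq IHq|p q Hpq Hp IH]; intros alpha Ha p' Hp'.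
  - replace 0 with (c * 0) by apply Rmult_0_r.
    pose proof (is_RInt_gen_moment_rec (alpha + 1) ltac:(lra)) as M.
    refine (is_RInt_gen_ext_pos _ _ _ _ (is_RInt_gen_scal _ c _ M)).
    intros t Ht. rewrite laguerre_weight_mulX by trivial.
    replace (p' t) with 0.
    + replace (alpha + 1 - 1) with alpha by ring.
      unfold scal; simpl; unfold mult; simpl. ring.
    + rewrite <- (is_derive_unique _ _ _ (Hp' t)). symmetry; apply Derive_const.
  - destruct (polynomial_derive p Hp) as [d Hd].
    specialize (IH (alpha + 1) ltac:(lra) d Hd).
    refine (is_laguerre_integral_ext _ _ _ _ _
      (proj1 (is_laguerre_integral_mulX _ _ _) IH)). intros t _.
    replace (p' t) with (p t + t * d t); [ring|].
    rewrite <- (is_derive_unique _ _ _ (Hp' t)). symmetry. apply is_derive_unique.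
    now apply is_derive_mulX.
  - destruct (polynomial_derive p Hp) as [dp Hdp], (polynomial_derive q Hq) as [dq Hdq].
    replace 0 with (0 + 0) by ring.
    refine (is_laguerre_integral_ext _ _ _ _ _
      (is_laguerre_integral_plus _ _ _ _ _ (IHp _ Ha _ Hdp) (IHq _ Ha _ Hdq))).
    intros t _. simpl. replace (p' t) with (dp t + dq t); [ring|].
    rewrite <- (is_derive_unique _ _ _ (Hp' t)). symmetry. apply is_derive_unique.
    apply (is_derive_plus p q); trivial.
  - assert (Hp'' : forall t, is_derive p t (p' t)).
    { intros t. apply (is_derive_ext q); [symmetry; apply Hpq|apply Hp']. }
    refine (is_laguerre_integral_ext _ _ _ _ _ (IH alpha Ha p' Hp'')).
    intros t _; simpl; now rewrite Hpq.
Qed.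

Lemma laguerre_integral_ext alpha p q : -1 < alpha -> polynomial p ->
  (forall t, p t = q t) -> laguerre_integral alpha q = laguerre_integral alpha p.
Proof.
  intros Ha Hp Hpq. apply is_laguerre_integral_unique.
  refine (is_laguerre_integral_ext _ _ _ _ (fun t _ => Hpq t) _).
  now apply polynomial_integrable.
Qed.

Lemma laguerre_integral_plus alpha p q : -1 < alpha ->
  polynomial p -> polynomial q ->
  laguerre_integral alpha (fun t => p t + q t) =
  laguerre_integral alpha p + laguerre_integral alpha q.
Proof.
  intros Ha Hp Hq. apply is_laguerre_integral_unique, is_laguerre_integral_plus;
  now apply polynomial_integrable.
Qed.

Lemma laguerre_integral_scal alpha c p : -1 < alpha -> polynomial p ->
  laguerre_integral alpha (fun t => c * p t) = c * laguerre_integral alpha p.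
Proof.
  intros Ha Hp. now apply is_laguerre_integral_unique, is_laguerre_integral_scal,
    polynomial_integrable.
Qed.

(** * Laguerre polynomials *)

(** The pair [(L_k, L_k')], by the identities
    [(k + 1) L_(k+1) = (k + 1 + alpha - t) L_k + t L_k'] and
    [L_(k+1)' = L_k' - L_k].  As a first-order recursion it gives the
    three-term recurrence and the Abel summation for derivatives at no cost;
    that the second component is the derivative is part of [laguerre_ode]. *)
Fixpoint laguerre_pair (alpha : R) (k : nat) (t : R) : R * R :=
  match k with
  | O => (1, 0)
  | S j => let (L, D) := laguerre_pair alpha j t in
           (((INR (S j) + alpha - t) * L + t * D) / INR (S j), D - L)
  end.

Definition laguerre alpha k t := fst (laguerre_pair alpha k t).
Definition laguerre_deriv alpha k t := snd (laguerre_pair alpha k t).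

Lemma laguerreS alpha k t : laguerre alpha (S k) t =
  ((INR (S k) + alpha - t) * laguerre alpha k t + t * laguerre_deriv alpha k t)
  / INR (S k).
Proof.
  unfold laguerre, laguerre_deriv. cbn -[INR].
  now destruct (laguerre_pair alpha k t).
Qed.

Lemma laguerre_derivS alpha k t :
  laguerre_deriv alpha (S k) t = laguerre_deriv alpha k t - laguerre alpha k t.
Proof.
  unfold laguerre, laguerre_deriv. cbn -[INR].
  now destruct (laguerre_pair alpha k t).
Qed.

Lemma polynomial_minus p q : polynomial p -> polynomial q ->
  polynomial (fun t => p t - q t).
Proof.
  intros Hp Hq. apply polynomial_ext with (fun t => p t + (-1) * q t).
  { intros; ring. }
  apply polynomial_plus; trivial. now apply polynomial_scal.
Qed.

Lemma polynomial_laguerre_pair alpha k :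
  polynomial (laguerre alpha k) /\ polynomial (laguerre_deriv alpha k).
Proof.
  induction k as [|k [HL HD]].
  { split; [exact (polynomial_const 1)|exact (polynomial_const 0)]. }
  split.
  - apply polynomial_ext with (fun t => / INR (S k) *
      (((INR (S k) + alpha) * laguerre alpha k t - t * laguerre alpha k t)
       + t * laguerre_deriv alpha k t)).
    { intros t. rewrite laguerreS. unfold Rdiv. ring. }
    apply polynomial_scal, polynomial_plus; [apply polynomial_minus|];
      now (apply polynomial_scal || apply polynomial_mulX).
  - apply polynomial_ext with (fun t => laguerre_deriv alpha k t - laguerre alpha k t).
    { intros t; now rewrite laguerre_derivS. }
    now apply polynomial_minus.
Qed.

(** The derivative formula at [k + 1] uses the differential equation at [k], so
    the two are proved together. *)
Lemma laguerre_ode alpha k : exists D2 : R -> R, forall t,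
  is_derive (laguerre alpha k) t (laguerre_deriv alpha k t) /\
  is_derive (laguerre_deriv alpha k) t (D2 t) /\
  t * D2 t + (alpha + 1 - t) * laguerre_deriv alpha k t
    + INR k * laguerre alpha k t = 0.
Proof.
  induction k as [|k [D2 IH]].
  - exists (fun _ => 0). intros t. split; [|split].
    + exact (@is_derive_const R_AbsRing R_NormedModule 1 t).
    + exact (@is_derive_const R_AbsRing R_NormedModule 0 t).
    + unfold laguerre, laguerre_deriv; simpl. ring.
  - exists (fun t => D2 t - laguerre_deriv alpha k t).
    intros t; destruct (IH t) as (dL & dD & ode); split; [|split].
    + apply (is_derive_ext (fun t => ((INR (S k) + alpha - t) * laguerre alpha k t
        + t * laguerre_deriv alpha k t) / INR (S k))).
      { intros; symmetry; apply laguerreS. }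
      rewrite laguerre_derivS.
      assert (Hk : INR k + 1 <> 0) by (rewrite <- S_INR; now apply not_0_INR).
      rewrite S_INR. auto_derive.
      { repeat split; trivial; eexists; eassumption. }
      replace (Derive (fun x : R => laguerre alpha k x) t)
        with (laguerre_deriv alpha k t) by (symmetry; now apply is_derive_unique).
      replace (Derive (fun x : R => laguerre_deriv alpha k x) t)
        with (D2 t) by (symmetry; now apply is_derive_unique).
      replace (t * (1 * D2 t)) with (- ((alpha + 1 - t) * laguerre_deriv alpha k t
        + INR k * laguerre alpha k t)) by lra.
      now field.
    + apply (is_derive_ext (fun t => laguerre_deriv alpha k t - laguerre alpha k t)).
      { intros; symmetry; apply laguerre_derivS. }
      apply (is_derive_minus (laguerre_deriv alpha k)); trivial.
    + rewrite laguerreS, laguerre_derivS.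
      replace (t * (D2 t - laguerre_deriv alpha k t)) with (- ((alpha + 1 - t)
        * laguerre_deriv alpha k t + INR k * laguerre alpha k t)
        - t * laguerre_deriv alpha k t) by lra.
      rewrite S_INR. field. rewrite <- S_INR. now apply not_0_INR.
Qed.

Lemma polynomial_laguerre alpha k : polynomial (laguerre alpha k).
Proof. apply polynomial_laguerre_pair. Qed.

Lemma polynomial_laguerre_deriv alpha k : polynomial (laguerre_deriv alpha k).
Proof. apply polynomial_laguerre_pair. Qed.

Lemma is_derive_laguerre alpha k t :
  is_derive (laguerre alpha k) t (laguerre_deriv alpha k t).
Proof. destruct (laguerre_ode alpha k) as [D2 H]. apply H. Qed.

Definition laguerre_inner alpha (p q : R -> R) : R :=
  laguerre_integral alpha (fun t => p t * q t).

Section Inner.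
Variable alpha : R.
Hypothesis halpha : -1 < alpha.

Lemma laguerre_inner_comm p q : laguerre_inner alpha p q = laguerre_inner alpha q p.
Proof.
  unfold laguerre_inner. f_equal. extensionality t. apply Rmult_comm.
Qed.

Lemma laguerre_inner_plus p q r : polynomial p -> polynomial q -> polynomial r ->
  laguerre_inner alpha (fun t => p t + q t) r =
  laguerre_inner alpha p r + laguerre_inner alpha q r.
Proof.
  intros Hp Hq Hr. unfold laguerre_inner.
  rewrite <- laguerre_integral_plus by (trivial; now apply polynomial_mult).
  f_equal. extensionality t. ring.
Qed.

Lemma laguerre_inner_scal c p r : polynomial p -> polynomial r ->
  laguerre_inner alpha (fun t => c * p t) r = c * laguerre_inner alpha p r.
Proof.
  intros Hp Hr. unfold laguerre_inner.
  rewrite <- laguerre_integral_scal by (trivial; now apply polynomial_mult).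
  f_equal. extensionality t. ring.
Qed.

(** The divergence identity for [L_k' L_j], simplified with the differential
    equation.  Exchanging [j] and [k] leaves the left side unchanged, so
    eigenfunctions of index [j <> k] are orthogonal. *)
Lemma laguerre_inner_deriv j k :
  laguerre_inner alpha (fun t => t * laguerre_deriv alpha k t) (laguerre_deriv alpha j)
  = INR k * laguerre_inner alpha (laguerre alpha k) (laguerre alpha j).
Proof.
  destruct (laguerre_ode alpha k) as [D2 H].
  pose proof (polynomial_laguerre alpha) as PL.
  pose proof (polynomial_laguerre_deriv alpha) as PD.
  pose proof (is_laguerre_integral_divergence alpha
    (fun t => laguerre_deriv alpha k t * laguerre alpha j t)
    (fun t => D2 t * laguerre alpha j t + laguerre_deriv alpha k t * laguerre_deriv alpha j t)
    halpha (polynomial_mult _ _ (PD k) (PL j))) as Hdiv.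
  apply is_laguerre_integral_unique in Hdiv; [|intros t].
  - unfold laguerre_inner. rewrite <- laguerre_integral_scal by (trivial; now apply polynomial_mult).
    apply Rminus_diag_uniq. rewrite <- Hdiv at 1.
    unfold Rminus.
    replace (- laguerre_integral alpha (fun t => INR k * (laguerre alpha k t * laguerre alpha j t)))
      with (laguerre_integral alpha (fun t => (- INR k) * (laguerre alpha k t * laguerre alpha j t))).
    2:{ rewrite !laguerre_integral_scal by (trivial; now apply polynomial_mult). ring. }
    rewrite <- laguerre_integral_plus; trivial.
    + f_equal. extensionality t. destruct (H t) as (_ & _ & ode).
      replace (- INR k * (laguerre alpha k t * laguerre alpha j t)) with
        (- (INR k * laguerre alpha k t) * laguerre alpha j t) by ring.
      replace (INR k * laguerre alpha k t) with
        (- (t * D2 t + (alpha + 1 - t) * laguerre_deriv alpha k t)) by lra.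
      ring.
    + apply (polynomial_mult (fun t => t * laguerre_deriv alpha k t)); trivial.
      now apply polynomial_mulX.
    + now apply polynomial_scal, polynomial_mult.
  - apply (is_derive_mult (laguerre_deriv alpha k) (laguerre alpha j)).
    + apply H.
    + apply is_derive_laguerre.
    + intros; apply Rmult_comm.
Qed.

Lemma laguerre_orthogonal j k : j <> k ->
  laguerre_inner alpha (laguerre alpha j) (laguerre alpha k) = 0.
Proof.
  intros Hjk.
  pose proof (laguerre_inner_deriv j k) as H1.
  pose proof (laguerre_inner_deriv k j) as H2.
  rewrite (laguerre_inner_comm (laguerre alpha k)) in H1.
  assert (E : laguerre_inner alpha (fun t => t * laguerre_deriv alpha k t) (laguerre_deriv alpha j)
    = laguerre_inner alpha (fun t => t * laguerre_deriv alpha j t) (laguerre_deriv alpha k)).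
  { unfold laguerre_inner. f_equal. extensionality t. ring. }
  assert (Hn : INR j <> INR k) by now apply not_INR.
  apply Rmult_eq_reg_l with (INR k - INR j); lra.
Qed.

Definition laguerre_sqnorm k := laguerre_inner alpha (laguerre alpha k) (laguerre alpha k).

(** [L_k'] is a combination of [L_0, ..., L_(k-1)]. *)
Lemma laguerre_inner_deriv_high m k : (k <= m)%nat ->
  laguerre_inner alpha (laguerre_deriv alpha k) (laguerre alpha m) = 0.
Proof.
  induction k as [|k IH]; intros Hkm.
  - replace (laguerre_deriv alpha 0) with (fun t => 0 * laguerre_deriv alpha 0 t).
    + rewrite laguerre_inner_scal. ring.
      apply polynomial_laguerre_deriv. apply polynomial_laguerre.
    + extensionality t. unfold laguerre_deriv; simpl; ring.
  - replace (laguerre_deriv alpha (S k)) with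
      (fun t => laguerre_deriv alpha k t + (-1) * laguerre alpha k t).
    + rewrite laguerre_inner_plus, laguerre_inner_scal, IH, laguerre_orthogonal by
        (try lia; try apply polynomial_scal; apply polynomial_laguerre || apply polynomial_laguerre_deriv).
      ring.
    + extensionality t. rewrite laguerre_derivS. ring.
Qed.

Lemma laguerre_mulX_deriv k t : t * laguerre_deriv alpha (S k) t =
  INR (S k) * laguerre alpha (S k) t - (INR (S k) + alpha) * laguerre alpha k t.
Proof.
  rewrite laguerreS, laguerre_derivS. field. now apply not_0_INR.
Qed.

(** Here [(k + 1) h_(k+1)] is the integral of [t (L_(k+1)')^2]; expand
    [t L_(k+1)'] by [laguerre_mulX_deriv], and only
    [<L_k, L_(k+1)'> = - h_k] survives. *)
Lemma laguerre_sqnormS k :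
  INR (S k) * laguerre_sqnorm (S k) = (INR k + (alpha + 1)) * laguerre_sqnorm k.
Proof.
  unfold laguerre_sqnorm. rewrite <- laguerre_inner_deriv.
  replace (fun t => t * laguerre_deriv alpha (S k) t) with
    (fun t => INR (S k) * laguerre alpha (S k) t + (- (INR (S k) + alpha)) * laguerre alpha k t).
  2:{ extensionality t. rewrite laguerre_mulX_deriv. ring. }
  pose proof (polynomial_laguerre alpha) as PL.
  pose proof (polynomial_laguerre_deriv alpha) as PD.
  rewrite laguerre_inner_plus, !laguerre_inner_scal by (trivial; now apply polynomial_scal).
  rewrite (laguerre_inner_comm (laguerre alpha (S k))), laguerre_inner_deriv_high by lia.
  rewrite laguerre_inner_comm.
  replace (laguerre_deriv alpha (S k)) with
    (fun t => laguerre_deriv alpha k t + (-1) * laguerre alpha k t).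
  2:{ extensionality t. rewrite laguerre_derivS. ring. }
  rewrite laguerre_inner_plus, laguerre_inner_scal, laguerre_inner_deriv_high
    by (trivial; now apply polynomial_scal).
  rewrite S_INR. ring.
Qed.

Lemma laguerre_sqnorm0 : 0 < laguerre_sqnorm 0.
Proof.
  destruct (is_RInt_gen_laguerre_weight alpha halpha) as (l & Hl & Hpos).
  unfold laguerre_sqnorm, laguerre_inner.
  replace (laguerre_integral _ _) with l; trivial. symmetry.
  apply is_laguerre_integral_unique.
  refine (is_RInt_gen_ext_pos _ _ _ _ Hl). intros t _. unfold laguerre; simpl. ring.
Qed.

Lemma laguerre_sqnorm_pos k : 0 < laguerre_sqnorm k.
Proof.
  induction k as [|k IH]; [apply laguerre_sqnorm0|].
  apply Rmult_lt_reg_l with (INR (S k)); [apply lt_0_INR; lia|].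
  rewrite Rmult_0_r, laguerre_sqnormS. pose proof (pos_INR k).
  apply Rmult_lt_0_compat; lra.
Qed.

Definition laguerre_sum (c : nat -> R) n t :=
  sum_f_R0 (fun k => c k * laguerre alpha k t) n.

Lemma polynomial_laguerre_sum c n : polynomial (laguerre_sum c n).
Proof. apply polynomial_sum. apply polynomial_laguerre. Qed.

Lemma laguerre_inner_sum_high c n m : (n < m)%nat ->
  laguerre_inner alpha (laguerre_sum c n) (laguerre alpha m) = 0.
Proof.
  pose proof (polynomial_laguerre alpha) as PL.
  induction n as [|n IH]; intros Hnm; unfold laguerre_sum; simpl.
  - rewrite laguerre_inner_scal, laguerre_orthogonal by (trivial; lia). ring.
  - rewrite (laguerre_inner_plus (laguerre_sum c n)), laguerre_inner_scal,
      laguerre_orthogonal, IH by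
      (trivial; try lia; try apply polynomial_scal; trivial; apply polynomial_laguerre_sum).
    ring.
Qed.

Lemma laguerre_parseval c n :
  laguerre_inner alpha (laguerre_sum c n) (laguerre_sum c n) =
  sum_f_R0 (fun k => laguerre_sqnorm k * c k ^ 2) n.
Proof.
  pose proof (polynomial_laguerre alpha) as PL.
  induction n as [|n IH]; unfold laguerre_sum; cbn [sum_f_R0].
  - rewrite laguerre_inner_scal, laguerre_inner_comm, laguerre_inner_scal
      by (trivial; now apply polynomial_scal).
    unfold laguerre_sqnorm; ring.
  - pose proof (polynomial_laguerre_sum c n) as PS.
    assert (PT : polynomial (fun t => c (S n) * laguerre alpha (S n) t))
      by now apply polynomial_scal.
    rewrite (laguerre_inner_plus (laguerre_sum c n))
      by (trivial; now apply polynomial_plus).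
    rewrite laguerre_inner_comm, (laguerre_inner_plus (laguerre_sum c n)) by trivial.
    rewrite IH, laguerre_inner_scal by trivial.
    rewrite (laguerre_inner_comm (laguerre alpha (S n))), laguerre_inner_sum_high by lia.
    rewrite laguerre_inner_scal by (trivial; now apply polynomial_plus).
    rewrite laguerre_inner_comm, (laguerre_inner_plus (laguerre_sum c n)) by trivial.
    rewrite laguerre_inner_sum_high, laguerre_inner_scal by (trivial; lia).
    unfold laguerre_sqnorm; ring.
Qed.

Lemma laguerre_norm_sum c n p : (forall t, p t = laguerre_sum c n t) ->
  laguerre_norm alpha p = sqrt (sum_f_R0 (fun k => laguerre_sqnorm k * c k ^ 2) n).
Proof.
  intros Hp. rewrite <- laguerre_parseval. unfold laguerre_norm, laguerre_inner, laguerre_integral.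
  f_equal. f_equal. extensionality t. rewrite Hp. f_equal.
  rewrite pow2_abs. ring.
Qed.

Lemma laguerre_deriv_sum n t :
  laguerre_deriv alpha (S n) t = - sum_f_R0 (fun k => laguerre alpha k t) n.
Proof.
  induction n as [|n IH]; rewrite laguerre_derivS.
  - unfold laguerre_deriv; simpl; ring.
  - rewrite IH. cbn [sum_f_R0]. ring.
Qed.

(** Summation by parts.  Including [k = n], where the coefficient is [0], keeps
    the range of summation the same as for [p]. *)
Lemma Derive_laguerre_sum c n t : let C := sum_f_R0 c in
  Derive (laguerre_sum c n) t = laguerre_sum (fun k => C k - C n) n t.
Proof.
  intros C. apply is_derive_unique.
  induction n as [|n IH].
  - unfold laguerre_sum; simpl. unfold C; simpl. evar_last.
    + apply is_derive_scal. apply is_derive_laguerre.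
    + unfold laguerre_deriv; simpl; ring.
  - evar_last.
    + apply (is_derive_plus (laguerre_sum c n) (fun t => c (S n) * laguerre alpha (S n) t)).
      apply IH. apply is_derive_scal. apply is_derive_laguerre.
    + unfold plus; simpl. rewrite laguerre_deriv_sum.
      unfold laguerre_sum. cbn [sum_f_R0].
      replace (sum_f_R0 (fun k => (C k - C (S n)) * laguerre alpha k t) n) with
        (sum_f_R0 (fun k => (C k - C n) * laguerre alpha k t
          + laguerre alpha k t * (- c (S n))) n).
      * rewrite plus_sum, <- scal_sum. ring.
      * apply sum_eq. intros k _. unfold C at 4; cbn [sum_f_R0]. fold (C n). ring.
Qed.

Lemma laguerre_norm_derive_sum c n p : let C := sum_f_R0 c in
  (forall t, p t = laguerre_sum c n t) ->
  laguerre_norm alpha (Derive p) =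
  sqrt (sum_f_R0 (fun k => laguerre_sqnorm k * (C n - C k) ^ 2) n).
Proof.
  intros C Hp. rewrite (laguerre_norm_sum (fun k => C k - C n) n).
  - f_equal. apply sum_eq. intros k _. ring.
  - intros t. transitivity (Derive (laguerre_sum c n) t);
      [now apply Derive_ext|apply Derive_laguerre_sum].
Qed.
End Inner.

(** * Expansions in Laguerre polynomials *)

(** [poly_le] is the instance where [f k] is the monomial [t^k], so one notion
    serves for both bases. *)
Definition spanned (f : nat -> R -> R) n (p : R -> R) : Prop :=
  exists c : nat -> R, forall t, p t = sum_f_R0 (fun k => c k * f k t) n.

Lemma spanned_ext f n p q : (forall t, p t = q t) -> spanned f n p -> spanned f n q.
Proof. intros E [c Hc]. exists c. intros t. now rewrite <- E. Qed.

Lemma spanned_plus f n p q : spanned f n p -> spanned f n q ->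
  spanned f n (fun t => p t + q t).
Proof.
  intros [c Hc] [d Hd]. exists (fun k => c k + d k). intros t.
  rewrite Hc, Hd, <- plus_sum. apply sum_eq; intros; ring.
Qed.

Lemma spanned_scal f n a p : spanned f n p -> spanned f n (fun t => a * p t).
Proof.
  intros [c Hc]. exists (fun k => a * c k). intros t.
  rewrite Hc, scal_sum. apply sum_eq; intros; ring.
Qed.

Lemma spanned_le f m n p : (m <= n)%nat -> spanned f m p -> spanned f n p.
Proof.
  intros Hmn [c Hc]. exists (fun k => if (k <=? m)%nat then c k else 0).
  induction Hmn as [|n Hmn IH]; intros t.
  - rewrite Hc. apply sum_eq. intros k Hk. now rewrite (proj2 (Nat.leb_le k m) Hk).
  - cbn [sum_f_R0]. rewrite <- IH, (proj2 (Nat.leb_gt (S n) m)) by lia. ring.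
Qed.

Lemma spanned_basis f n : spanned f n (f n).
Proof.
  exists (fun k => if (k =? n)%nat then 1 else 0). intros t.
  assert (H : forall m, (m < n)%nat ->
    sum_f_R0 (fun k => (if (k =? n)%nat then 1 else 0) * f k t) m = 0).
  { induction m as [|m IH]; intros Hm; cbn [sum_f_R0]; [|rewrite IH by lia];
    rewrite (proj2 (Nat.eqb_neq _ n)) by lia; ring. }
  destruct n as [|n]; cbn [sum_f_R0]; [simpl; ring|].
  rewrite H, Nat.eqb_refl by lia. ring.
Qed.

Lemma spanned_sum f g n p : (forall k, (k <= n)%nat -> spanned g n (f k)) ->
  spanned f n p -> spanned g n p.
Proof.
  intros Hf [c Hc]. apply (spanned_ext g n _ _ (fun t => eq_sym (Hc t))).
  clear p Hc. assert (H : forall m, (m <= n)%nat ->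
    spanned g n (fun t => sum_f_R0 (fun k => c k * f k t) m)).
  { induction m as [|m IH]; intros Hm.
    - simpl. apply spanned_scal, Hf; lia.
    - apply (spanned_plus g n (fun t => sum_f_R0 (fun k => c k * f k t) m)
        (fun t => c (S m) * f (S m) t)).
      apply IH; lia. apply spanned_scal, Hf; lia. }
  now apply H.
Qed.

Lemma spanned_mulX f n p :
  (forall k, spanned f (S k) (fun t => t * f k t)) ->
  spanned f n p -> spanned f (S n) (fun t => t * p t).
Proof.
  intros Hf [c Hc].
  apply spanned_ext with (fun t => sum_f_R0 (fun k => c k * (t * f k t)) n).
  { intros t. rewrite Hc, scal_sum. apply sum_eq; intros; ring. }
  clear p Hc. induction n as [|n IH].
  - simpl. now apply (spanned_scal f 1 (c O) (fun t => t * f O t)).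
  - apply (spanned_plus f (S (S n)) (fun t => sum_f_R0 (fun k => c k * (t * f k t)) n)
      (fun t => c (S n) * (t * f (S n) t))).
    + apply spanned_le with (2 := IH); lia.
    + now apply (spanned_scal f _ _ (fun t => t * f (S n) t)).
Qed.

Lemma laguerre_mulX_spanned alpha k :
  spanned (laguerre alpha) (S k) (fun t => t * laguerre alpha k t).
Proof.
  assert (HL : forall j, (j <= S k)%nat -> spanned (laguerre alpha) (S k) (laguerre alpha j)).
  { intros j Hj. apply spanned_le with (1 := Hj), spanned_basis. }
  destruct k as [|k].
  - apply spanned_ext with (fun t => (1 + alpha) * laguerre alpha 0 t + (-1) * laguerre alpha 1 t).
    { intros t. unfold laguerre; simpl. field. }
    apply spanned_plus; apply spanned_scal, HL; lia.
  - apply spanned_ext with (fun t => (2 * INR (S k) + 1 + alpha) * laguerre alpha (S k) t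
      + ((- INR (S (S k))) * laguerre alpha (S (S k)) t + (- (INR (S k) + alpha)) * laguerre alpha k t)).
    { intros t. rewrite (laguerreS alpha (S k)), laguerre_mulX_deriv, (S_INR (S k)).
      field. rewrite <- S_INR. now apply not_0_INR. }
    apply spanned_plus; [|apply spanned_plus]; apply spanned_scal, HL; lia.
Qed.

(** By the three-term recurrence, multiplication by [t] maps the span of
    [L_0, ..., L_k] into that of [L_0, ..., L_(k+1)]; start from [1 = L_0]. *)
Lemma poly_le_spanned_laguerre alpha n p :
  poly_le n p -> spanned (laguerre alpha) n p.
Proof.
  intros Hp. apply (spanned_sum (fun k t => t ^ k)); [|exact Hp].
  intros k Hk. apply spanned_le with (1 := Hk). clear n p Hp Hk.
  induction k as [|k IH].
  - apply (spanned_basis (laguerre alpha) 0).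
  - apply (spanned_mulX _ k (fun t => t ^ k)); trivial. apply laguerre_mulX_spanned.
Qed.

Lemma laguerre_pair_poly_le alpha k :
  poly_le k (laguerre alpha k) /\ poly_le k (laguerre_deriv alpha k).
Proof.
  change (spanned (fun k t => t ^ k) k (laguerre alpha k) /\
    spanned (fun k t => t ^ k) k (laguerre_deriv alpha k)).
  assert (HX : forall n p, spanned (fun k t => t ^ k) n p ->
    spanned (fun k t => t ^ k) (S n) (fun t => t * p t)).
  { intros n p. apply spanned_mulX. intros j.
    exact (spanned_basis (fun k t => t ^ k) (S j)). }
  induction k as [|k [IHL IHD]].
  - split; [exists (fun _ => 1)|exists (fun _ => 0)]; intros t;
    unfold laguerre, laguerre_deriv; simpl; ring.
  - assert (HS : forall p, spanned (fun k t => t ^ k) k p -> spanned (fun k t => t ^ k) (S k) p)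
      by (intros p; apply spanned_le; lia).
    split.
    + apply spanned_ext with (fun t => / INR (S k) * ((INR (S k) + alpha) * laguerre alpha k t
        + ((-1) * (t * laguerre alpha k t) + t * laguerre_deriv alpha k t))).
      { intros t. rewrite laguerreS. unfold Rdiv. ring. }
      apply spanned_scal, spanned_plus; [now apply spanned_scal, HS|].
      apply spanned_plus; [|now apply HX].
      apply (spanned_scal _ _ (-1) (fun t => t * laguerre alpha k t)). now apply HX.
    + apply spanned_ext with (fun t => laguerre_deriv alpha k t + (-1) * laguerre alpha k t).
      { intros t. rewrite laguerre_derivS. ring. }
      apply spanned_plus; [|apply spanned_scal]; now apply HS.
Qed.

Lemma laguerre_sum_poly_le alpha c n : poly_le n (laguerre_sum alpha c n).
Proof.
  change (spanned (fun k t => t ^ k) n (laguerre_sum alpha c n)).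
  apply spanned_sum with (laguerre alpha).
  - intros k Hk. apply spanned_le with (1 := Hk). apply laguerre_pair_poly_le.
  - now exists c.
Qed.

(** * The Hardy inequality for real sequences *)

(** [n^(-6) * tr A^3] as a function of [y = 1 / n]; it is continuous at [0], so
    its value there is the leading coefficient. *)
Definition trace_scaled (s y : R) : R :=
  (y ^ 5 * (114 * s ^ 2 + 6 * s ^ 3)
   + y ^ 4 * (150 * s + 120 * s ^ 2 + 65 * s ^ 3 + 5 * s ^ 4)
   + y ^ 3 * (60 + 320 * s + 140 * s ^ 2 + 70 * s ^ 3 + 10 * s ^ 4)
   + y ^ 2 * (180 + 270 * s + 210 * s ^ 2 + 35 * s ^ 3 + 5 * s ^ 4)
   + y * (180 + 180 * s + 96 * s ^ 2 + 24 * s ^ 3)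
   + (60 + 80 * s + 20 * s ^ 2))
  / (20 * (s ^ 3 * (s + 1) * (s + 2) * (s + 3) * (s + 4))).

Lemma trace_scaled_pos s y : 0 < s -> 0 <= y -> 0 < trace_scaled s y.
Proof.
  intros Hs Hy. unfold trace_scaled. apply Rdiv_lt_0_compat.
  - apply Rplus_le_lt_0_compat.
    + repeat first [apply Rplus_le_le_0_compat | apply Rmult_le_pos | apply pow_le]; lra.
    + repeat first [apply Rplus_lt_0_compat | apply Rmult_lt_0_compat | apply pow_lt]; lra.
  - repeat first [apply Rmult_lt_0_compat | apply pow_lt]; lra.
Qed.

Section Bridge.
Import ssreflect ssrfun ssrbool eqtype ssrnat seq fintype bigop order ssralg ssrnum matrix.
Import Rstruct.

Lemma tail_sum (c : nat -> R) n j : (j <= n)%N ->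
  (\sum_(i < n | (j <= i)%N) c i.+1)%R = sum_f_R0 c n - sum_f_R0 c j.
Proof.
elim: n => [|n IHn].
  by rewrite leqn0 => /eqP ->; rewrite big_ord0 Rminus_diag.
rewrite leq_eqVlt => /orP[/eqP ->|].
  by rewrite big_pred0 ?Rminus_diag // => i; rewrite leqNgt ltn_ord.
rewrite ltnS => le_jn.
rewrite big_mkcond big_ord_recr /= -big_mkcond IHn // le_jn /= -RplusE; ring.
Qed.

Import ring.

Lemma trace_cubedE (s x : R) : 0 < s -> 0 < x ->
  trace_cubed s x = x ^ 6 * trace_scaled s (/ x).
Proof.
move=> /RltP s_gt0 /RltP x_gt0; rewrite /trace_cubed /trace_scaled !RealsE /=.
have [? ?] : s != 0%R /\ x != 0%R by rewrite !Num.Theory.lt0r_neq0.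
have ne k : (s + k.+1%:R)%R != 0%R.
  by rewrite Num.Theory.lt0r_neq0 // Num.Theory.addr_gt0 // Num.Theory.ltr0Sn.
have [? ? ? ?] := And4 (ne 0%N) (ne 1%N) (ne 2%N) (ne 3%N).
by field; do ?[apply/andP; split].
Qed.

(** [discrete_hardy] with the inner sums written as differences of partial sums. *)
Lemma hardy_cube_le (s : R) (h c : nat -> R) n :
  0 < INR n -> 0 < s -> 0 < h O ->
  (forall k, INR (S k) * h (S k) = (INR k + s) * h k) ->
  sum_f_R0 (fun j => h j * (sum_f_R0 c n - sum_f_R0 c j) ^ 2) n ^ 3 <=
  INR n ^ 6 * trace_scaled s (/ INR n) * sum_f_R0 (fun k => h k * c k ^ 2) n ^ 3.
Proof.
move=> n0 hs /RltP h0 hS; have /RltP s0 := hs.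
have hS' k : (k.+1%:R * h k.+1 = (k%:R + s) * h k)%R.
  by have := hS k; rewrite !RealsE.
have h_gt0 := weight_gt0 s0 h0 hS'.
have /RleP H := discrete_hardy s0 h0 hS' c n.
have -> : sum_f_R0 (fun j => h j * (sum_f_R0 c n - sum_f_R0 c j) ^ 2) n =
    (\sum_(j < n) h j * (\sum_(i < n | (j <= i)%N) c i.+1) ^+ 2)%R.
  rewrite sum_f_R0E big_mkord big_ord_recr /=.
  rewrite Rminus_diag Rmult_0_l Rmult_0_r GRing.addr0; apply: eq_bigr => j _.
  by rewrite tail_sum ?Rmult_1_r // ltnW.
have -> : sum_f_R0 (fun k => h k * c k ^ 2) n =
    h O * c O ^ 2 + (\sum_(i < n) h i.+1 * c i.+1 ^+ 2)%R.
  rewrite sum_f_R0E big_mkord big_ord_recl; congr (_ + _).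
  by apply: eq_bigr => i _; rewrite RpowE.
rewrite -INRE trace_cubedE // -!RpowE in H.
apply: (Rle_trans _ _ _ H).
apply: Rmult_le_compat_l.
  apply: Rmult_le_pos; first exact/pow_le/Rlt_le.
  by apply/Rlt_le/trace_scaled_pos => //; apply/Rlt_le/Rinv_0_lt_compat.
apply: pow_incr; split.
  by apply/RleP/Num.Theory.sumr_ge0 => i _; rewrite Num.Theory.mulr_ge0 ?Num.Theory.sqr_ge0 ?Order.POrderTheory.ltW.
have /RltP h0' := h_gt0 O.
rewrite -[X in X <= _]Rplus_0_l; apply: Rplus_le_compat_r.
exact: Rmult_le_pos (Rlt_le _ _ h0') (pow2_ge_0 (c O)).
Qed.

End Bridge.

(** * The test vector *)

Lemma sum_f_R0_INR n : sum_f_R0 INR n = INR n * (INR n + 1) / 2.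
Proof.
  induction n as [|n IH]; [simpl; lra|]. cbn [sum_f_R0]. rewrite IH, S_INR. field.
Qed.

Section TestVector.
Variables (s : R) (h : nat -> R).
Hypothesis hs : 0 < s.
Hypothesis hS : forall k, INR (S k) * h (S k) = (INR k + s) * h k.

Lemma weightS k : h (S k) = (INR k + s) / (INR k + 1) * h k.
Proof.
  assert (INR k + 1 <> 0) by (rewrite <- S_INR; now apply not_0_INR).
  apply Rmult_eq_reg_l with (INR (S k)); [|now apply not_0_INR].
  rewrite hS, S_INR. now field.
Qed.

Ltac moment n IH :=
  induction n as [|n IH]; [cbn [sum_f_R0 INR]; field; lra|];
  cbn [sum_f_R0]; rewrite IH, weightS, S_INR; field;
  pose proof (pos_INR n); repeat split; lra.

Lemma moment_sq n : sum_f_R0 (fun k => h k * INR k ^ 2) n =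
  (INR n + s) * h n * INR n * (INR n * (s + 1) + 1) / ((s + 1) * (s + 2)).
Proof. moment n IH. Qed.

Lemma moment0 n : sum_f_R0 h n = (INR n + s) * h n / s.
Proof. moment n IH. Qed.

Lemma moment1 n : sum_f_R0 (fun k => h k * (INR k * (INR k + 1))) n =
  (INR n + s) * h n * (INR n * (INR n - 1) / (s + 2) + 2 * INR n / (s + 1)).
Proof. moment n IH. Qed.

Lemma moment2 n : sum_f_R0 (fun k => h k * (INR k * (INR k + 1)) ^ 2) n =
  (INR n + s) * h n *
  (INR n * (INR n - 1) * (INR n - 2) * (INR n - 3) / (s + 4)
   + 8 * INR n * (INR n - 1) * (INR n - 2) / (s + 3)
   + 14 * INR n * (INR n - 1) / (s + 2) + 4 * INR n / (s + 1)).
Proof. moment n IH. Qed.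

(** [n^(-2)] times the Rayleigh quotient of the vector [c_k = k], as a function
    of [y = 1 / n]. *)
Definition test_ratio (y : R) : R :=
  ((1 + y) ^ 2 / s - 2 * (1 + y) * ((1 - y) / (s + 2) + 2 * y / (s + 1))
   + (1 - y) * (1 - 2 * y) * (1 - 3 * y) / (s + 4)
   + 8 * y * (1 - y) * (1 - 2 * y) / (s + 3)
   + 14 * y ^ 2 * (1 - y) / (s + 2) + 4 * y ^ 3 / (s + 1))
  * (s + 1) * (s + 2) / (4 * (s + 1 + y)).

(** Here [C_n - C_k = (n (n + 1) - k (k + 1)) / 2], so expanding the square
    leaves the moments of [k (k + 1)] of order 0, 1 and 2. *)
Lemma test_vector_ratio n : (0 < n)%nat ->
  sum_f_R0 (fun k => h k * (sum_f_R0 INR n - sum_f_R0 INR k) ^ 2) n =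
  INR n ^ 2 * test_ratio (/ INR n) * sum_f_R0 (fun k => h k * INR k ^ 2) n.
Proof.
  intros Hn. apply lt_INR in Hn. simpl in Hn.
  rewrite moment_sq.
  replace (sum_f_R0 (fun k => h k * (sum_f_R0 INR n - sum_f_R0 INR k) ^ 2) n) with
    ((INR n * (INR n + 1)) ^ 2 / 4 * sum_f_R0 h n
     - INR n * (INR n + 1) / 2 * sum_f_R0 (fun k => h k * (INR k * (INR k + 1))) n
     + / 4 * sum_f_R0 (fun k => h k * (INR k * (INR k + 1)) ^ 2) n).
  - rewrite moment0, moment1, moment2. unfold test_ratio. field.
    repeat split; try lra.
    assert (0 < (s + 1) * INR n) by (apply Rmult_lt_0_compat; lra). lra.
  - rewrite !scal_sum, <- minus_sum, <- plus_sum. apply sum_eq. intros k _.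
    rewrite !sum_f_R0_INR. field.
Qed.
End TestVector.

Lemma is_lim_seq_inv_INR (f : R -> R) : continuous f 0 ->
  is_lim_seq (fun n => f (/ INR n)) (f 0).
Proof.
  intros Cf. apply (is_lim_seq_continuous f (fun n => / INR n) 0).
  - now apply continuity_pt_filterlim.
  - replace (Finite 0) with (Rbar_inv p_infty) by reflexivity.
    apply is_lim_seq_inv; [apply is_lim_seq_INR|easy].
Qed.

Lemma pow_le_reg x y n : 0 <= y -> x ^ S n <= y ^ S n -> x <= y.
Proof.
  intros Hy Hxy. apply Rnot_lt_le. intros Hlt. apply (Rle_not_lt _ _ Hxy).
  simpl. apply Rle_lt_trans with (y * x ^ n).
  - apply Rmult_le_compat_l; [easy|]. apply pow_incr; lra.
  - apply Rmult_lt_compat_r; [apply pow_lt|]; lra.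
Qed.

(** * Bounds for the Markov constants *)

Section Markov.
Variable alpha : R.
Hypothesis halpha : -1 < alpha.
Let h := laguerre_sqnorm alpha.
Let s := alpha + 1.

Lemma sum_sqnorm_pos c n : (exists t, laguerre_sum alpha c n t <> 0) ->
  0 < sum_f_R0 (fun k => h k * c k ^ 2) n.
Proof.
  assert (Hh : forall k, 0 < h k) by exact (laguerre_sqnorm_pos alpha halpha).
  intros [t Ht]. apply Rnot_le_lt. intros Hle. apply Ht.
  assert (Hz : forall k, (k <= n)%nat -> c k = 0).
  { intros k Hk. apply Rsqr_0_uniq. unfold Rsqr.
    apply Rmult_eq_reg_l with (h k); [|apply Rgt_not_eq, Hh].
    apply Rle_antisym.
    - rewrite Rmult_0_r. apply Rle_trans with (2 := Hle).
      replace (h k * (c k * c k)) with (h k * c k ^ 2) by ring.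
      clear - Hk Hh. induction n as [|n IH].
      + replace k with O by lia. simpl; lra.
      + cbn [sum_f_R0]. destruct (Nat.eq_dec k (S n)) as [->|Hne].
        * assert (0 <= sum_f_R0 (fun k => h k * c k ^ 2) n); [|lra].
          apply cond_pos_sum. intros j. apply Rmult_le_pos; [left; apply Hh|apply pow2_ge_0].
        * pose proof (IH ltac:(lia)).
          pose proof (Rmult_le_pos _ _ (Rlt_le _ _ (Hh (S n))) (pow2_ge_0 (c (S n)))). lra.
    - rewrite Rmult_0_r. apply Rmult_le_pos; [left; apply Hh|apply Rle_0_sqr]. }
  unfold laguerre_sum. rewrite <- (Rmult_0_l (INR (S n))), <- sum_cte.
  apply sum_eq. intros k Hk. rewrite Hz by easy. ring.
Qed.

(** Everything is compared after raising to the sixth power: the ratio of norms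
    is a square root, and the Hardy inequality bounds a cube. *)
Lemma markov_upper n p : (0 < n)%nat -> poly_le n p -> (exists t, p t <> 0) ->
  laguerre_norm alpha (Derive p) / laguerre_norm alpha p <=
  INR n * Rpower (trace_scaled s (/ INR n)) (1 / 6).
Proof.
  intros Hn Hp [t Ht]. pose proof (lt_INR _ _ Hn) as Hn'. simpl in Hn'.
  destruct (poly_le_spanned_laguerre alpha n p Hp) as [c Hc].
  rewrite (laguerre_norm_sum alpha halpha c n p Hc),
    (laguerre_norm_derive_sum alpha halpha c n p Hc).
  set (N := sum_f_R0 (fun k => laguerre_sqnorm alpha k * c k ^ 2) n).
  set (Q := sum_f_R0 _ n).
  assert (HN : 0 < N).
  { apply sum_sqnorm_pos. exists t. unfold laguerre_sum. now rewrite <- Hc. }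
  assert (HQ : Q ^ 3 <= INR n ^ 6 * trace_scaled s (/ INR n) * N ^ 3).
  { apply hardy_cube_le; [easy|unfold s; lra|now apply laguerre_sqnorm_pos|].
    intros k. now apply laguerre_sqnormS. }
  assert (HQ0 : 0 <= Q).
  { apply cond_pos_sum. intros k. apply Rmult_le_pos; [|apply pow2_ge_0].
    left; now apply laguerre_sqnorm_pos. }
  assert (HT : 0 < trace_scaled s (/ INR n)).
  { apply trace_scaled_pos; [unfold s; lra|now left; apply Rinv_0_lt_compat]. }
  set (T := trace_scaled s (/ INR n)) in *.
  rewrite <- sqrt_div_alt by trivial.
  set (x := sqrt (Q / N)). assert (Hx0 : 0 <= x) by apply sqrt_pos.
  assert (Hx2 : x ^ 2 = Q / N) by (apply pow2_sqrt, Rdiv_le_0_compat; trivial).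
  set (y := INR n * Rpower T (1 / 6)).
  assert (Hy0 : 0 < y) by (apply Rmult_lt_0_compat; [easy|apply exp_pos]).
  assert (Hy6 : y ^ 6 = INR n ^ 6 * T).
  { unfold y. rewrite Rpow_mult_distr. f_equal.
    rewrite <- Rpower_pow by apply exp_pos. rewrite Rpower_mult.
    replace (1 / 6 * INR 6) with 1 by (simpl; field). now apply Rpower_1. }
  assert (Hx6 : x ^ 6 <= y ^ 6).
  { rewrite Hy6. change 6%nat with (2 * 3)%nat at 1. rewrite pow_mult, Hx2.
    unfold Rdiv. rewrite Rpow_mult_distr, pow_inv. apply Rle_div_l; [now apply pow_lt|easy]. }
  apply pow_le_reg with 5%nat; lra.
Qed.

(** The first part is needed because [real] sends [p_infty] to [0], which would
    spoil the lower bound. *)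
Lemma markov_const_upper n : (0 < n)%nat ->
  markov_const alpha n <> p_infty /\
  real (markov_const alpha n) <= INR n * Rpower (trace_scaled s (/ INR n)) (1 / 6).
Proof.
  intros Hn. set (C := INR n * _).
  assert (HC : Rbar_le (markov_const alpha n) (Finite C)).
  { apply Lub_Rbar_correct. intros r (p & Hp & Hp0 & ->). simpl.
    now apply markov_upper. }
  assert (0 <= C) by (apply Rmult_le_pos; [apply pos_INR|left; apply exp_pos]).
  destruct (markov_const alpha n); simpl in *; easy.
Qed.

Lemma markov_lower n : (0 < n)%nat ->
  INR n * sqrt (test_ratio s (/ INR n)) <= real (markov_const alpha n).
Proof.
  intros Hn. pose proof (lt_INR _ _ Hn) as Hn'. simpl in Hn'.
  set (p := laguerre_sum alpha INR n).
  assert (HN : 0 < sum_f_R0 (fun k => laguerre_sqnorm alpha k * INR k ^ 2) n).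
  { destruct n as [|n]; [lia|]. cbn [sum_f_R0].
    apply Rplus_le_lt_0_compat.
    - apply cond_pos_sum. intros k. apply Rmult_le_pos; [|apply pow2_ge_0].
      left; now apply laguerre_sqnorm_pos.
    - apply Rmult_lt_0_compat; [now apply laguerre_sqnorm_pos|now apply pow_lt]. }
  assert (Hp0 : exists t, p t <> 0).
  { apply Classical_Prop.NNPP. intros Hno.
    assert (Hz : forall t, p t = 0).
    { intros t. apply Classical_Prop.NNPP. intros H; apply Hno; now exists t. }
    apply (Rlt_not_eq _ _ HN).
    rewrite <- laguerre_parseval by trivial.
    unfold laguerre_inner.
    rewrite (laguerre_integral_ext alpha (fun _ => 0 * 0)); trivial.
    - rewrite laguerre_integral_scal; [ring|trivial|apply (polynomial_const 0)].
    - apply (polynomial_const (0 * 0)).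
    - intros t. fold p. now rewrite Hz. }
  assert (Hr : laguerre_norm alpha (Derive p) / laguerre_norm alpha p =
    INR n * sqrt (test_ratio s (/ INR n))).
  { rewrite (laguerre_norm_sum alpha halpha INR n p (fun t => eq_refl)),
      (laguerre_norm_derive_sum alpha halpha INR n p (fun t => eq_refl)).
    rewrite <- sqrt_div_alt by trivial.
    rewrite (test_vector_ratio s); [|unfold s; lra| |trivial].
    2:{ intros k. now apply laguerre_sqnormS. }
    unfold Rdiv. rewrite Rmult_assoc, Rinv_r, Rmult_1_r by lra.
    rewrite sqrt_mult_alt by apply pow2_ge_0. rewrite sqrt_pow2 by lra. reflexivity. }
  rewrite <- Hr.
  assert (Hle : Rbar_le (Finite (laguerre_norm alpha (Derive p) / laguerre_norm alpha p))
     (markov_const alpha n)).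
  { apply Lub_Rbar_correct. exists p. repeat split; trivial. apply laguerre_sum_poly_le. }
  destruct (markov_const_upper n Hn) as [Hfin _].
  destruct (markov_const alpha n); easy.
Qed.
End Markov.

Lemma Lim_seq_lower (u v : nat -> R) l : (forall n, (0 < n)%nat -> v n <= u n) ->
  is_lim_seq v l -> Rbar_le l (Lim_seq u).
Proof.
  intros H Hv. rewrite <- (is_lim_seq_unique _ _ Hv).
  apply Lim_seq_le_loc. exists 1%nat. intros n Hn. apply H. lia.
Qed.

Lemma Lim_seq_upper (u v : nat -> R) l : (forall n, (0 < n)%nat -> u n <= v n) ->
  is_lim_seq v l -> Rbar_le (Lim_seq u) l.
Proof.
  intros H Hv. rewrite <- (is_lim_seq_unique _ _ Hv).
  apply Lim_seq_le_loc. exists 1%nat. intros n Hn. apply H. lia.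
Qed.

Theorem corollary1 (alpha : R) (halpha : -1 < alpha) :
  Rbar_le (Finite (sqrt 2 / sqrt ((alpha + 1) * (alpha + 5))))
          (asymptotic_markov_const alpha) /\
  Rbar_le (asymptotic_markov_const alpha)
          (Finite (1 / (sqrt (alpha + 1) *
                        Rpower ((alpha + 3) * (alpha + 5)) (1 / 6)))).
Proof.
  assert (Hs : 0 < alpha + 1) by lra.
  split; unfold asymptotic_markov_const.
  - apply Lim_seq_lower with (fun n => sqrt (test_ratio (alpha + 1) (/ INR n))).
    + intros n Hn. pose proof (lt_INR _ _ Hn) as Hn'. simpl in Hn'.
      apply Rle_div_r; trivial. rewrite Rmult_comm. now apply markov_lower.
    + replace (sqrt 2 / sqrt ((alpha + 1) * (alpha + 5)))
        with (sqrt (test_ratio (alpha + 1) 0)).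
      * apply (is_lim_seq_inv_INR (fun y => sqrt (test_ratio (alpha + 1) y))).
        apply (continuous_comp (test_ratio (alpha + 1)) sqrt); [|apply continuous_sqrt].
        apply (ex_derive_continuous (test_ratio (alpha + 1))).
        unfold test_ratio. auto_derive. lra.
      * rewrite <- sqrt_div_alt by nra. f_equal. unfold test_ratio. field.
        repeat split; lra.
  - apply Lim_seq_upper with (fun n => Rpower (trace_scaled (alpha + 1) (/ INR n)) (1 / 6)).
    + intros n Hn. pose proof (lt_INR _ _ Hn) as Hn'. simpl in Hn'.
      apply Rle_div_l; trivial. rewrite Rmult_comm. now apply markov_const_upper.
    + assert (HT : trace_scaled (alpha + 1) 0 =
        / ((alpha + 1) ^ 3 * ((alpha + 3) * (alpha + 5)))).
      { unfold trace_scaled. field. repeat split; lra. }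
      assert (H35 : 0 < (alpha + 3) * (alpha + 5)) by nra.
      assert (Hpow : 0 < (alpha + 1) ^ 3) by now apply pow_lt.
      replace (1 / (sqrt (alpha + 1) * Rpower ((alpha + 3) * (alpha + 5)) (1 / 6)))
        with (Rpower (trace_scaled (alpha + 1) 0) (1 / 6)).
      * apply (is_lim_seq_inv_INR (fun y => Rpower (trace_scaled (alpha + 1) y) (1 / 6))).
        apply (continuous_comp (trace_scaled (alpha + 1)) (fun x => Rpower x (1 / 6))).
        -- apply (ex_derive_continuous (trace_scaled (alpha + 1))).
           unfold trace_scaled. auto_derive. trivial.
        -- apply continuous_Rpower. rewrite HT. apply Rinv_0_lt_compat. nra.
      * rewrite HT. rewrite <- Rpower_sqrt by trivial.
        rewrite <- Rpower_pow by trivial.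
        unfold Rpower at 1. rewrite ln_Rinv by (rewrite Rpower_pow by trivial; nra).
        rewrite ln_mult by (trivial; apply exp_pos).
        unfold Rpower. rewrite ln_exp. unfold Rdiv at 2. rewrite Rmult_1_l, <- exp_plus, <- exp_Ropp.
        f_equal. simpl. field.
Qed.
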